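(* (a) Suppose $s,t,m,n,k\geq 3$ are integers satisfying $\log_n m\leq \frac{s^{k-2}}{k!\,\log^{2k} s}$ and $k\leq \frac{s}{2\log^3 s}$. If $t>k^s\cdot e^{2s/\log s}$, then $z(m,n;s,t)=\Omega_s(mn^{1-1/s})$ (i.e. $z(m,n;s,t)\geq c_s mn^{1-1/s}$ for a constant $c_s>0$ depending only on $s$). In particular, $z(n,n;s,t)=\Omega_s(n^{2-1/s})$ for $t>3^{s+o(s)}$. (b) For each $s\geq 3$ there is a constant $c_s>0$ such that if $\log_n m\leq c_s t^{\frac{1}{1+2\log s}}$, then $z(m,n;s,t)=\Omega_s(mn^{1-1/s})$.
   Context: A sided graph is a bipartite graph with a distinguished left part and right part. $K_{s,t}$ regarded as a sided graph has $s$ vertices on the left and $t$ vertices on the right; a sided graph contains a sided $K_{s,t}$ if it has $s$ left vertices and $t$ right vertices all mutually adjacent across the parts. $z(m,n;s,t)$ denotes the largest number of edges in a sided graph with $m$ vertices on the left and $n$ vertices on the right that contains no sided $K_{s,t}$. $\log$ denotes the natural logarithm. *)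

(* Defs.v *)
From mathcomp Require Import all_boot all_order all_algebra.
From mathcomp Require Import all_classical all_reals all_analysis.

Set Implicit Arguments.
Unset Strict Implicit.
Unset Printing Implicit Defensive.

Import Order.TTheory GRing.Theory Num.Theory.
Import numFieldNormedType.Exports.

(* A sided graph with left part V and right part W is given by its edges,
   written as pairs (left end, right end). *)
Definition sided_graph (V W : finType) : Type := {set V * W}.

Definition contains_sided_K (V W : finType) (G : sided_graph V W) (s t : nat)
    : bool :=
  [exists A : {set V}, exists B : {set W},
    [&& #|A| == s, #|B| == t & finset.setX A B \subset (G : {set V * W})]].

(* For s, t > 0 the empty graph contains no sided K_{s,t}, so the maximum is
   over a nonempty family; otherwise the value may be the junk value 0. *)
Definition zarankiewicz (m n s t : nat) : nat :=
  \max_(G : {set 'I_m * 'I_n} | ~~ contains_sided_K G s t) #|G|.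

(* The logarithm of x to base b, with ln the natural logarithm; only meaningful
   for b > 0, b <> 1 and x > 0. *)
Definition logb (R : realType) (b x : R) : R := (ln x / ln b)%R.

(* Main.v *)
(* Right vertices are points x of an affine space over F_q, left vertices are
   forms f of degree k, dehomogenized and normalized by a popular constant, and
   f is adjacent to x when f(x) = 0; the points are cut down to a set of the right
   size by further equations g_1 = ... = g_r = 0. The f are chosen one after the
   other, and then the g_i, so that any s of the f form together with the g_i a
   regular sequence of homogeneous polynomials. Few forms are bad for a given
   sequence: if y is a Noether normalization of the quotient by the ideal I it
   generates, then h satisfies modulo I a polynomial relation over F_q[y], and
   h + p, with p a form in y, can be a zero divisor only if -p is a root of it.
   Hence every coset of F_q[y]_k contains boundedly many bad forms, and a good form
   exists as soon as q ^ dim F_q[y]_k exceeds the number of sequences to be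
   extended, up to that bound. Bezout's inequality for regular sequences then
   bounds the number of common neighbours of s left vertices by k ^ s times the
   degrees of the g_i. *)

From HB Require Import structures.
From mathcomp Require Import all_boot all_order all_algebra all_field.
From mathcomp Require mpoly boolp.
From mathcomp Require Import zify ring lra.
Require Import Defs.

Set Implicit Arguments.
Unset Strict Implicit.
Unset Printing Implicit Defensive.

(** The obstacle is that the field is finite: a Noether normalization has to be updated over F_q
    itself, which takes a point where some form of degree T does not vanish, hence T < q. So all
    auxiliary degrees are bounded by a power of K, a number above all chosen degrees and the number
    of variables, with an exponent depending on s and r alone. The points live in dimension s + r,
    and r equations cut them down to dimension s, with q^s comparable to n. A larger r gives more
    forms to choose from, but the degrees of the g_i multiply the Bezout bound. If M is the required
    dimension, of order at least s^2 log_n m, the equation chosen among forms in e + 1 variables has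
    degree at most e M^(1/e), so the logarithm of the product of degrees is at most r log r + log M
    (1 + log r). With r about s / log^2 s this is the factor e^(2s/log s) of (a); with r = s - 1 and
    left degree at most s M^(1/s) it is the exponent 1/(1 + 2 log s) of (b). When n is too small
    against t for q to exceed the power of K, (b) relies on a random colouring instead. *)

Module RegularSequences.
Import mpoly.
Import GRing.Theory.
Local Open Scope ring_scope.

(** * Graded ideals and regular sequences of forms *)

Section Ideal.
Variables (n : nat) (F : fieldType).
Local Notation R := {mpoly F[n]}.
Implicit Types (p q r a b : R) (hs : seq R).

(** Membership peels off one cofactor per generator, so that induction on the list exposes the
    coefficient of the form adjoined last. *)
Fixpoint ideal hs p : Prop :=
  if hs is h :: hs' then exists r, ideal hs' (p - h * r) else p = 0.

Lemma ideal0 hs : ideal hs 0.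
Proof. by elim: hs => //= h hs IH; exists 0; rewrite mulr0 subr0. Qed.

Lemma idealD hs p q : ideal hs p -> ideal hs q -> ideal hs (p + q).
Proof.
elim: hs p q => [|h hs IH] p q /=; first by move=> -> ->; rewrite addr0.
move=> [r Hr] [s Hs]; exists (r + s).
by rewrite mulrDr opprD addrACA; apply: IH.
Qed.

Lemma idealMl hs p q : ideal hs p -> ideal hs (q * p).
Proof.
elim: hs p => [|h hs IH] p /=; first by move=> ->; rewrite mulr0.
move=> [r Hr]; exists (q * r).
by rewrite mulrCA -mulrBr; apply: IH.
Qed.

Lemma idealN hs p : ideal hs p -> ideal hs (- p).
Proof. by rewrite -mulN1r; apply: idealMl. Qed.

Lemma idealB hs p q : ideal hs p -> ideal hs q -> ideal hs (p - q).
Proof. by move=> Hp Hq; apply: idealD => //; apply: idealN. Qed.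

Lemma idealMr hs p q : ideal hs p -> ideal hs (p * q).
Proof. by rewrite mulrC; apply: idealMl. Qed.

Lemma ideal_sum hs (I : Type) (s : seq I) (P : pred I) (G : I -> R) :
  (forall i, P i -> ideal hs (G i)) -> ideal hs (\sum_(i <- s | P i) G i).
Proof.
by move=> H; apply: (big_ind (ideal hs)) => //; [apply: ideal0|apply: idealD].
Qed.

Lemma ideal_tail h hs p : ideal hs p -> ideal (h :: hs) p.
Proof. by move=> Hp; exists 0; rewrite mulr0 subr0. Qed.

Lemma ideal_mem hs h : h \in hs -> ideal hs h.
Proof.
elim: hs => //= g hs IH; rewrite inE => /orP[/eqP ->|/IH]; last exact: ideal_tail.
by exists 1; rewrite mulr1 subrr; apply: ideal0.
Qed.

Lemma ideal_le hs hs' p :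
  (forall h, h \in hs -> ideal hs' h) -> ideal hs p -> ideal hs' p.
Proof.
elim: hs p => [|h hs IH] p H /=; first by move=> ->; apply: ideal0.
move=> [r Hr]; rewrite -[p](subrK (h * r)); apply: idealD.
  by apply: IH Hr => g Hg; apply: H; rewrite inE Hg orbT.
by apply: idealMr; apply: H; rewrite inE eqxx.
Qed.

Lemma ideal_sub hs hs' p : {subset hs <= hs'} -> ideal hs p -> ideal hs' p.
Proof. by move=> H; apply: ideal_le => h /H; apply: ideal_mem. Qed.

Lemma idealP_sub hs p q : ideal hs (p - q) -> ideal hs q -> ideal hs p.
Proof. by move=> H1 H2; rewrite -[p](subrK q); apply: idealD. Qed.

Lemma ideal_rmorph (S : nzRingType) (phi : {rmorphism R -> S}) hs p :
  {in hs, forall h, phi h = 0} -> ideal hs p -> phi p = 0.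
Proof.
elim: hs p => [|h hs IH] p H /=; first by move=> ->; rewrite rmorph0.
move=> [r /IH Hr]; have: phi (p - h * r) = 0.
  by apply: Hr => g Hg; apply: H; rewrite inE Hg orbT.
by rewrite rmorphB rmorphM (H h) ?inE ?eqxx // mul0r subr0.
Qed.

Definition form p := exists2 d, (0 < d)%N & p \is d.-homog.
Definition forms hs := forall h, h \in hs -> form h.

Lemma pihomogM_homog d e p h : h \is e.-homog ->
  pihomog mdeg d (h * p) =
  if (e <= d)%N then h * pihomog mdeg (d - e) p else 0.
Proof.
move=> Hh; set k := msize p.
have Ek : (msize p <= k)%N by [].
rewrite {1}(pihomog_partitionE (mf := mdeg) Ek) mulr_sumr raddf_sum /=.
have Hterm (i : nat) : pihomog mdeg d (h * pihomog mdeg i p) =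
    if (e + i == d)%N then h * pihomog mdeg i p else 0.
  have Hi : h * pihomog mdeg i p \is (e + i).-homog.
    by apply: dhomogM => //; apply: pihomogP.
  case: eqP => [<-|/eqP ne]; first by rewrite pihomog_dE.
  by rewrite (pihomog_ne0 _ Hi) // eq_sym.
under eq_bigr => i _ do rewrite Hterm.
case: leqP => [le|lt]; last first.
  by rewrite big1 // => i _; case: eqP => // E; move: lt; rewrite -E ltnNge leq_addr.
case: (ltnP (d - e) k) => [lk|gk].
  rewrite (bigD1 (Ordinal lk)) //= subnKC // eqxx big1 ?addr0 // => i ne.
  case: eqP => // E; case/eqP: ne; apply/val_inj => /=.
  by rewrite -E addKn.
rewrite big1 => [|i _]; last first.
  case: eqP => // E; move: (ltn_ord i).
  by rewrite -(addKn e i) E ltnNge gk.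
rewrite (_ : pihomog mdeg (d - e) p = 0) ?mulr0 //.
rewrite pihomogE big_seq_cond big1 // => m /andP[Hm /eqP Em].
by move: (msize_mdeg_lt Hm); rewrite Em ltnNge gk.
Qed.

(** An ideal generated by forms is graded; hence the homogeneous cofactors of [ideal_consP]. *)
Lemma ideal_pihomog hs d p : forms hs -> ideal hs p -> ideal hs (pihomog mdeg d p).
Proof.
elim: hs p => [|h hs IH] p Hf /=; first by move=> ->; rewrite pihomog0.
have [e _ He] : form h by apply: Hf; rewrite inE eqxx.
move=> [r Hr]; have {Hr} : ideal hs (pihomog mdeg d (p - h * r)).
  by apply: IH Hr => g Hg; apply: Hf; rewrite inE Hg orbT.
rewrite pihomogB (pihomogM_homog _ _ He); case: ifP => _ H.
  by exists (pihomog mdeg (d - e) r).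
by exists 0; rewrite mulr0.
Qed.

Lemma ideal_consP h hs d e p : forms (h :: hs) -> h \is e.-homog ->
  p \is d.-homog -> ideal (h :: hs) p ->
  exists r, [/\ ideal hs (p - h * r), (e <= d)%N -> r \is (d - e).-homog
              & (d < e)%N -> r = 0].
Proof.
move=> Hf He Hp [r Hr].
have Hf' : forms hs by move=> g Hg; apply: Hf; rewrite inE Hg orbT.
have := ideal_pihomog d Hf' Hr.
rewrite pihomogB (pihomog_dE Hp) (pihomogM_homog _ _ He).
case: leqP => [le|lt] H.
  exists (pihomog mdeg (d - e) r); split=> // _; exact: pihomogP.
by exists 0; rewrite mulr0; split.
Qed.

(* Only homogeneous multipliers are tested; as the ideal is graded this is the
   usual notion. *)
Definition nzd hs a :=
  forall d p, p \is d.-homog -> ideal hs (a * p) -> ideal hs p.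

(* The elements are listed from last to first. *)
Fixpoint regular hs : Prop :=
  if hs is h :: hs' then nzd hs' h /\ regular hs' else True.

Lemma eq_ideal_nzd hs hs' a : (forall p, ideal hs p <-> ideal hs' p) ->
  nzd hs a -> nzd hs' a.
Proof. by move=> E H d p Hp /E Ha; apply/E/(H d p Hp). Qed.

Lemma perm_ideal hs hs' p : hs =i hs' -> ideal hs p <-> ideal hs' p.
Proof. by move=> E; split; apply: ideal_sub => x; rewrite E. Qed.

(** A graded Nakayama argument: if b p lies in the ideal of [hs], then p = a r modulo it and b r
    lies there again, with r of smaller degree because a has positive degree. So the order of a
    regular sequence of forms is immaterial, and parameters and forms can be moved past each
    other. *)
Lemma regular_swap a b hs : forms [:: a, b & hs] ->
  regular [:: b, a & hs] -> regular [:: a, b & hs].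
Proof.
move=> Hf [Hb [Ha Hr]].
have Fa : form a by apply: Hf; rewrite inE eqxx.
have Fb : form b by apply: Hf; rewrite !inE eqxx orbT.
have Fs : forms hs by move=> g Hg; apply: Hf; rewrite !inE Hg !orbT.
have Fas : forms (a :: hs) by move=> g; rewrite inE => /orP[/eqP ->|/Fs].
case: (Fa) => da da0 Hda; case: (Fb) => db db0 Hdb.
have Hb' : nzd hs b.
  move=> d; elim/ltn_ind: d => d IH p Hp Hbp.
  have Hap : ideal (a :: hs) p by apply: (Hb d) => //; apply: ideal_tail.
  have [r [H1 H2 H3]] := ideal_consP Fas Hda Hp Hap.
  case: (leqP da d) => [le|lt]; last by move: H1; rewrite H3 // mulr0 subr0.
  have Hr2 := H2 le.
  have dpos : (d - da < d)%N by rewrite ltn_subrL da0 (leq_trans da0 le).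
  have Hbr : ideal hs (b * r).
    apply: (Ha (db + (d - da))%N); first exact: dhomogM.
    rewrite (_ : a * (b * r) = b * p - b * (p - a * r)).
      by apply: idealB => //; apply: idealMl.
    by rewrite -mulrBr opprB addrC subrK mulrCA.
  by apply: (idealP_sub H1); apply: idealMl; apply: (IH (d - da)%N).
have Fbs : forms (b :: hs) by move=> g; rewrite inE => /orP[/eqP ->|/Fs].
split=> // d p Hp Hap.
have [r [H1 H2 H3]] := ideal_consP Fbs Hdb (dhomogM Hda Hp) Hap.
case: (leqP db (da + d)) => [le|lt]; last first.
  by apply: ideal_tail; apply: (Ha d) => //; move: H1; rewrite H3 // mulr0 subr0.
have Hr2 := H2 le.
have Hra : ideal (a :: hs) r.
  apply: (Hb _ _ Hr2); exists p.
  by rewrite -opprB; apply: idealN.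
have [t [T1 T2 T3]] := ideal_consP Fas Hda Hr2 Hra.
have Ht : ideal hs (a * (p - b * t)).
  rewrite (_ : _ * _ = (a * p - b * r) + b * (r - a * t)).
    by apply: idealD => //; apply: idealMl.
  by rewrite !mulrBr (mulrCA b) addrA subrK.
exists t; apply: (Ha d) Ht.
case: (leqP da (da + d - db)) => [le2|lt2]; last by rewrite T3 // mulr0 subr0.
have dbd : (db <= d)%N.
  by move: le2; rewrite leq_subRL // addnC leq_add2l.
rewrite rpredB //; have := dhomogM Hdb (T2 le2).
by rewrite subnAC addKn subnKC.
Qed.

Lemma forms_cat hs1 hs2 : forms (hs1 ++ hs2) <-> forms hs1 /\ forms hs2.
Proof.
split=> [H|[H1 H2] h]; last by rewrite mem_cat => /orP[/H1|/H2].
by split=> h Hh; apply: H; rewrite mem_cat Hh ?orbT.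
Qed.

Lemma forms_cons h hs : forms (h :: hs) <-> form h /\ forms hs.
Proof.
split=> [H|[H1 H2] g]; last by rewrite inE => /orP[/eqP ->|/H2].
by split=> [|g Hg]; apply: H; rewrite inE ?eqxx ?Hg ?orbT.
Qed.

Lemma regular_pull a l hs : forms (l ++ a :: hs) ->
  regular (l ++ a :: hs) -> regular (a :: l ++ hs).
Proof.
elim: l => //= b l IH Hf [Hb Hl].
have [Fb Fl] := (forms_cons _ _).1 Hf.
have Hal : regular [:: a & l ++ hs] by apply: IH.
apply: regular_swap.
  move=> g; rewrite !inE mem_cat => Hg; apply: Hf.
  by rewrite /= !(inE, mem_cat); case/or4P: Hg => ->; rewrite ?orbT.
split=> //; apply: eq_ideal_nzd Hb => p; apply: perm_ideal => x.
by rewrite inE !mem_cat inE orbCA.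
Qed.

Lemma regular_push a l hs : forms (a :: l ++ hs) ->
  regular (a :: l ++ hs) -> regular (l ++ a :: hs).
Proof.
elim: l => //= b l IH Hf Hr.
have Hf' : forms [:: b, a & l ++ hs].
  by move=> g; rewrite !inE orbCA => Hg; apply: Hf; rewrite !inE.
have [Hb Hl] := regular_swap Hf' Hr.
split; last first.
  by apply: IH => //; move=> g Hg; apply: Hf'; rewrite inE Hg orbT.
apply: eq_ideal_nzd Hb => p; apply: perm_ideal => x.
by rewrite inE !mem_cat inE orbCA.
Qed.

(** If b p lies in the ideal then so does a^e p, and the factors a cancel one at a time. This is how
    every new form is shown to be a nonzerodivisor. *)
Lemma nzd_exchange hs a b e :
  nzd hs a -> form a -> ideal (b :: hs) (a ^+ e) -> nzd hs b.
Proof.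
move=> Ha [da _ Hda] [r Hr] d p Hp Hbp.
have Hae : ideal hs (a ^+ e * p).
  rewrite -[a ^+ e](subrK (b * r)) mulrDl; apply: idealD; first exact: idealMr.
  by rewrite mulrAC; apply: idealMr.
elim: e {Hr} Hae => [|e IH]; first by rewrite expr0 mul1r.
rewrite exprS -mulrA => H; apply: IH.
by apply: (Ha (da * e + d)%N) H; apply: dhomogM => //; apply: dhomogMn.
Qed.

End Ideal.
End RegularSequences.

(** * Nonzero polynomials of degree below q do not vanish identically *)

Module NonVanishing.
Import mpoly.
Import GRing.Theory.
Local Open Scope ring_scope.

Section Interpolation.
Variables (d : nat) (F : finFieldType).
Local Notation q := #|F|.


Definition indicator (a : F) : {poly F} :=
  let P := \prod_(b <- rem a (enum F)) ('X - b%:P) in P.[a]^-1 *: P.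

Lemma size_indicator a : (size (indicator a) <= q)%N.
Proof.
rewrite /indicator (leq_trans (size_scale_leq _ _)) //.
rewrite size_prod_XsubC size_rem ?mem_enum // -cardE.
by rewrite prednK //; apply/card_gt0P; exists a.
Qed.

Lemma horner_indicator a x : (indicator a).[x] = (x == a)%:R.
Proof.
rewrite /indicator hornerZ; case: eqP => [->|/eqP ne].
  rewrite mulVf //; set P := \prod_(_ <- _) _.
  rewrite -[_ == 0]/(root P a) root_prod_XsubC rem_filter ?enum_uniq //.
  by rewrite mem_filter /= eqxx.
set P := \prod_(_ <- _) _; suff /rootP -> : root P x by rewrite mulr0.
rewrite root_prod_XsubC rem_filter ?enum_uniq //.
by rewrite mem_filter /= ne mem_enum.
Qed.

Definition monomial_sum (c : {ffun {ffun 'I_d -> 'I_q} -> F}) :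
    {ffun {ffun 'I_d -> F} -> F} :=
  [ffun v : {ffun 'I_d -> F} =>
     \sum_(m : {ffun 'I_d -> 'I_q}) c m * \prod_i v i ^+ m i].

(* Surjective by interpolation, hence injective by cardinality. *)
Lemma monomial_sum_inj : injective monomial_sum.
Proof.
suff H g : g \in codom monomial_sum.
  have /image_injP Hi : #|image monomial_sum predT| == #|{ffun {ffun 'I_d -> 'I_q} -> F}|.
    rewrite (eq_card (B := predT)) => [|g]; last by rewrite H.
    by rewrite !card_ffun !card_ord.
  by move=> x y; apply: Hi.
apply/codomP.
exists [ffun m : {ffun 'I_d -> 'I_q} => \sum_a g a * \prod_i (indicator (a i))`_(m i)].
apply/ffunP => v; rewrite ffunE.
under eq_bigr => m _ do rewrite ffunE mulr_suml.
rewrite exchange_big /= (bigD1 v) //= [X in _ + X]big1 => [|a ne].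
  rewrite addr0; under eq_bigr => m _ do rewrite -mulrA -big_split /=.
  rewrite -mulr_sumr -(bigA_distr_bigA (fun i (j : 'I_q) => (indicator (v i))`_j * v i ^+ j)) /=.
  rewrite big1 ?mulr1 // => i _.
  by rewrite -horner_coef_wide ?size_indicator // horner_indicator eqxx.
under eq_bigr => m _ do rewrite -mulrA -big_split /=.
rewrite -mulr_sumr -(bigA_distr_bigA (fun i (j : 'I_q) => (indicator (a i))`_j * v i ^+ j)) /=.
have [i Hi] : exists i, v i != a i.
  apply/existsP; move: ne; apply: contraNT; rewrite negb_exists => /forallP E.
  by apply/eqP/ffunP => i; apply/esym/eqP; move: (E i); rewrite negbK.
rewrite (bigD1 i) //= -horner_coef_wide ?size_indicator // horner_indicator.
by rewrite (negbTE Hi) mul0r mulr0.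
Qed.

Definition mnm_of (m : {ffun 'I_d -> 'I_q}) : 'X_{1..d} := [multinom (m i : nat) | i < d].

Lemma mnm_of_inj : injective mnm_of.
Proof.
move=> m m' /mnmP E; apply/ffunP => i; apply/val_inj.
by move: (E i); rewrite !mnmE.
Qed.

(** Total degree below q forces each exponent below q, so p is a reduced polynomial and
    [monomial_sum_inj] applies. As [msize] is the degree plus one, the bound says exactly degree <
    q. *)
Lemma nonvanishing_point (p : {mpoly F[d]}) :
  p != 0 -> (msize p <= q)%N -> exists v, p.@[v] != 0.
Proof.
move=> p0 sp.
have Esupp m : m \in msupp p -> exists m', m = mnm_of m'.
  move=> /msize_mdeg_lt lt.
  have lti i : (m i < q)%N.
    apply: (leq_ltn_trans _ (leq_trans lt sp)).
    by rewrite mdegE (bigD1 i) //= leq_addr.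
  exists [ffun i => Ordinal (lti i)]; apply/mnmP => i.
  by rewrite mnmE ffunE.
pose c : {ffun {ffun 'I_d -> 'I_q} -> F} := [ffun m => p@_(mnm_of m)].
have Ev (v : {ffun 'I_d -> F}) : p.@[v] = monomial_sum c v.
  rewrite ffunE mevalE.
  under [RHS]eq_bigr => m _.
    rewrite ffunE.
    rewrite (_ : \prod_i _ = \prod_i v i ^+ (mnm_of m) i); last first.
      by apply: eq_bigr => i _; rewrite mnmE.
    over.
  rewrite (bigID (fun m => mnm_of m \in msupp p)) /= [X in _ + X]big1 => [|m Hm]; last first.
    by rewrite memN_msupp_eq0 // mul0r.
  rewrite addr0 -(big_map mnm_of (mem (msupp p)) (fun m => p@_m * \prod_i v i ^+ m i)).
  rewrite -[RHS]big_filter; apply: perm_big; apply: uniq_perm.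
  - exact: msupp_uniq.
  - by rewrite filter_uniq // map_inj_uniq ?index_enum_uniq //; apply: mnm_of_inj.
  move=> m; rewrite mem_filter /=; case Hm: (m \in msupp p) => //=.
  by have [m' ->] := Esupp _ Hm; rewrite map_f // mem_index_enum.
have [[v Hv]|Hz] : (exists v, monomial_sum c v != 0) \/ monomial_sum c = 0.
  case: (boolP [exists v, monomial_sum c v != 0]) => [/existsP|]; first by left.
  rewrite negb_exists => /forallP E; right; apply/ffunP => v.
  by rewrite [RHS]ffunE; apply/eqP; move: (E v); rewrite negbK.
  by exists v; rewrite Ev.
have c0 : c = 0.
  apply: monomial_sum_inj; rewrite Hz; apply/ffunP => v; rewrite !ffunE big1 // => m _.
  by rewrite ffunE mul0r.
case/eqP: p0; apply/mpolyP => m; rewrite mcoeff0.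
case Hm: (m \in msupp p); last by rewrite memN_msupp_eq0 ?Hm.
have [m' E] := Esupp _ Hm.
by rewrite E; have := congr1 (fun f : {ffun _ -> F} => f m') c0; rewrite !ffunE.
Qed.

End Interpolation.
End NonVanishing.

(** * Noether normalization and its update when a form is adjoined *)

Module Normalization.
Import mpoly RegularSequences NonVanishing.
Import GRing.Theory.
Local Open Scope ring_scope.

Section Congruence.
Variables (n : nat) (F : fieldType).
Local Notation R := {mpoly F[n]}.
Implicit Types (p q r a b : R) (hs : seq R).

Lemma ideal_congrM J a b a' b' :
  ideal J (a - b) -> ideal J (a' - b') -> ideal J (a * a' - b * b').
Proof.
move=> H H'; rewrite (_ : _ - _ = a * (a' - b') + (a - b) * b').
  by apply: idealD; [apply: idealMl|apply: idealMr].
by rewrite mulrBr mulrBl addrA subrK.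
Qed.

Lemma mmap_congr d J (f g : 'I_d -> R) (D : {mpoly F[d]}) :
  (forall i, ideal J (f i - g i)) ->
  ideal J (mmap (@mpolyC n F) f D - mmap (@mpolyC n F) g D).
Proof.
move=> H; rewrite /mmap -sumrB; apply: ideal_sum => m _.
rewrite -mulrBr; apply: idealMl.
apply: (big_ind2 (fun x y => ideal J (x - y))) => [|x1 x2 y1 y2|i _].
- by rewrite subrr; apply: ideal0.
- exact: ideal_congrM.
elim: (m i) => [|k IH]; first by rewrite !expr0 subrr; apply: ideal0.
by rewrite !exprS; apply: ideal_congrM.
Qed.

Lemma homog_mmap_line d (S : comNzRingType) (phi : {rmorphism F -> S}) T
  (l : 'I_d -> F) (y : S) (D : {mpoly F[d]}) : D \is T.-homog ->
  mmap phi (fun i => phi (l i) * y) D = phi D.@[l] * y ^+ T.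
Proof.
move=> HD; rewrite mevalE rmorph_sum mulr_suml /mmap !big_seq.
apply: eq_bigr => m Hm; rewrite rmorphM -mulrA; congr (_ * _).
have Em : mdeg m = T := dhomog_mf HD Hm.
rewrite /mmap1 rmorph_prod -Em mdegE.
rewrite (eq_bigr (fun i => phi (l i) ^+ m i * y ^+ m i)) => [|i _]; last first.
  by rewrite exprMn.
rewrite big_split /=; congr (_ * _); first by apply: eq_bigr => i _; rewrite rmorphXn.
by rewrite -(big_morph _ (exprD y) (expr0 y)).
Qed.

Lemma homog_mmap d T k (ys : 'I_d -> R) (D : {mpoly F[d]}) :
  (forall i, ys i \is k.-homog) -> D \is T.-homog ->
  mmap (@mpolyC n F) ys D \is (k * T).-homog.
Proof.
move=> Hy HD; rewrite /mmap big_seq; apply: rpred_sum => m Hm.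
rewrite mul_mpolyC; apply: rpredZ.
have Em : mdeg m = T := dhomog_mf HD Hm.
rewrite -Em mdegE big_distrr /=.
apply: (big_ind2 (fun (x : R) e => x \is e.-homog)) => [|x1 x2 y1 y2|i _].
- exact: dhomog1.
- exact: dhomogM.
exact: dhomogMn.
Qed.

Lemma eq_ideal_map (I : eqType) (s : seq I) (f g : I -> R) J p :
  (forall i, i \in s -> ideal J (f i - g i)) ->
  ideal (map f s ++ J) p -> ideal (map g s ++ J) p.
Proof.
move=> H; apply: ideal_le => x; rewrite mem_cat => /orP[/mapP[i Hi ->]|Hx]; last first.
  by apply: ideal_mem; rewrite mem_cat Hx orbT.
rewrite -[f i](subrK (g i)); apply: idealD.
  by apply: (ideal_sub (hs := J)) (H i Hi) => y Hy; rewrite mem_cat Hy orbT.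
by apply: ideal_mem; rewrite mem_cat map_f.
Qed.

(** Regularity depends only on residues modulo [J]. Used with y0 in [J], to replace each parameter
    y_i by y_i - c_i y0. *)
Lemma regular_map (I : eqType) (s : seq I) (f g : I -> R) J :
  (forall i, i \in s -> ideal J (f i - g i)) ->
  regular (map f s ++ J) -> regular (map g s ++ J).
Proof.
elim: s => //= i s IH H [Hn Hr].
have H' j : j \in s -> ideal J (f j - g j) by move=> Hj; apply: H; rewrite inE Hj orbT.
have H'' j : j \in s -> ideal J (g j - f j) by move=> Hj; rewrite -opprB; apply/idealN/H'.
split; last exact: IH.
move=> d p Hp Hgp; apply: (eq_ideal_map H'); apply: (Hn d) => //.
rewrite -[f i](subrK (g i)) mulrDl; apply: idealD; last exact: eq_ideal_map Hgp.
apply: idealMr; apply: (ideal_sub (hs := J)); last by apply: H; rewrite inE eqxx.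
by move=> y Hy; rewrite mem_cat Hy orbT.
Qed.

End Congruence.

Section NormalizationStep.
Variables (n : nat) (F : finFieldType).
Local Notation R := {mpoly F[n]}.
Implicit Types (p q r a b : R) (hs ys : seq R).

Definition lines ys := forall y, y \in ys -> y \is 1.-homog.

(** The quotient vanishes in degrees from [T0] on. The bound is explicit because the size of the
    field will be compared with it. *)
Definition exhausted T0 hs :=
  forall T p, (T0 <= T)%N -> p \is T.-homog -> ideal hs p.

(* [ys] is a Noether normalization of the quotient by [hs], and forms of degree
   at least [T0] are generated over it by those of smaller degree. *)
Definition normalizes T0 ys hs :=
  [/\ lines ys, forms hs, regular (ys ++ hs) & exhausted T0 (ys ++ hs)].

Lemma lines_forms ys : lines ys -> forms ys.
Proof. by move=> H y /H Hy; exists 1%N. Qed.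

Definition eval_at ys d (D : {mpoly F[d]}) : R :=
  mmap (@mpolyC n F) (fun i : 'I_d => ys`_i) D.

(** A form of degree at least T0 + T can be divided by y modulo [J] T times over, and y^T is zero
    there. *)
Lemma exhausted_pow T0 J y T : (0 < T0)%N -> exhausted T0 (y :: J) -> y \is 1.-homog ->
  forms (y :: J) -> ideal J (y ^+ T) -> exhausted (T0 + T) J.
Proof.
move=> T00 HE Hy Hf HJ.
have H e : forall T' p, (T0 + e <= T')%N -> p \is T'.-homog ->
    exists r, [/\ ideal J (p - y ^+ e * r) & r \is (T' - e).-homog].
  elim: e => [|e IH] T' p le Hp.
    exists p; rewrite expr0 mul1r subrr subn0; split=> //; exact: ideal0.
  have le' : (T0 + e <= T')%N by apply: leq_trans le; rewrite leq_add2l.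
  have [r [H1 H2]] := IH T' p le' Hp.
  have leT : (T0 <= T' - e)%N by rewrite leq_subRL ?(leq_trans _ le') ?leq_addl // addnC.
  have [t [H3 H4 _]] := ideal_consP Hf Hy H2 (HE _ _ leT H2).
  exists t; split; last first.
    by rewrite -subnDA addn1 in H4; apply: H4; apply: leq_trans T00 leT.
  rewrite (_ : _ - _ = (p - y ^+ e * r) + y ^+ e * (r - y * t)).
    by apply: idealD => //; apply: idealMl.
  by rewrite mulrBr addrA subrK exprSr -mulrA.
move=> T' p le Hp; have [r [H1 _]] := H T T' p le Hp.
by apply: (idealP_sub H1); apply: idealMr.
Qed.

(** D is a nonzero relation between the parameters modulo [h]. Choose a direction l with D(l)
    nonzero and subtract multiples of one parameter y0 from the others: modulo the new parameters D
    becomes D(l) y0^T. So y0^T lies in the ideal of [h], the new parameters and [hs], and [h] can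
    take the place of y0. The bound T < #|F| provides the direction. *)
Lemma normalizes_cons T0 ys hs h T d (D : {mpoly F[d]}) :
  size ys = d -> (0 < T0)%N -> normalizes T0 ys hs -> form h ->
  D != 0 -> D \is T.-homog -> (0 < T < #|F|)%N ->
  ideal (h :: hs) (eval_at ys D) ->
  exists2 ys', (size ys').+1 = d & normalizes (T0 + T) ys' (h :: hs).
Proof.
move=> Ed; case: _ / Ed D => D T00 [Hl Hf Hr HE] Fh D0 HD /andP[T_gt0 ltT] HhD.
have [|v Hv] := nonvanishing_point D0.
  rewrite msizeE; apply/bigmax_leqP_seq => m Hm _.
  by have Em : mdeg m = T := dhomog_mf HD Hm; rewrite Em.
(* A form of positive degree vanishes at the origin, so v is not the origin. *)
have [i0 Hi0] : exists i0, v i0 != 0.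
  apply/existsP; move: Hv; apply: contraNT; rewrite negb_exists => /forallP E.
  rewrite mevalE big_seq big1 // => m Hm.
  have Em : mdeg m = T := dhomog_mf HD Hm.
  have [i Hi] : exists i, m i != 0%N.
    apply/existsP; move: T_gt0; apply: contraTT; rewrite negb_exists => /forallP Z.
    by rewrite -Em mdegE big1 // => i _; apply/eqP; move: (Z i); rewrite negbK.
  rewrite (bigD1 i) //=; move: (E i); rewrite negbK => /eqP ->.
  by rewrite expr0n (negbTE Hi) mul0r mulr0.
pose l i := v i / v i0.
have Hl0 : D.@[l] != 0.
  move: Hv; apply: contraNN => /eqP E.
  have := homog_mmap_line idfun l (v i0) HD.
  rewrite /= E mul0r => <-; apply/eqP.
  by apply: meval_eq => i; rewrite /l /= divfK.
pose y0 := ys`_i0.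
have Hy0 : y0 \is 1.-homog by apply/Hl/mem_nth.
pose ys1 := take i0 ys; pose ys2 := drop i0.+1 ys.
have Eys : ys = ys1 ++ y0 :: ys2.
  by rewrite /ys1 /ys2 /y0 -drop_nth // cat_take_drop.
(* [l] extended by 0 to all naturals, so that it can be mapped over the index list [js]. *)
pose c (i : nat) : F := if insub i is Some j then l j else 0.
have Ec (i : 'I_(size ys)) : c i = l i by rewrite /c valK.
pose js := iota 0 i0 ++ iota i0.+1 (size ys - i0.+1).
pose zs := [seq ys`_i - c i *: y0 | i <- js].
have Ejs : ys1 ++ ys2 = [seq ys`_i | i <- js].
  rewrite map_cat map_nth_iota0 ?(ltnW (ltn_ord i0)) // map_nth_iota //.
  by rewrite (take_oversize (s := drop _ _)) // size_drop.
have mem_js i : i \in js -> (i < size ys)%N.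
  rewrite mem_cat !mem_iota subnKC // => /orP[|] /andP[_ //] lt.
  exact: (ltn_trans lt (ltn_ord i0)).
have szs : (size zs).+1 = size ys.
  by rewrite Eys size_cat /= addnS -size_cat Ejs !size_map.
have Hlz : lines zs.
  move=> y /mapP[i /mem_js Hi ->]; apply: rpredB; first by apply/Hl/mem_nth.
  exact: rpredZ.
have Hmem (i : 'I_(size ys)) : i != i0 -> ys`_i - c i *: y0 \in zs.
  move=> ne; apply: (map_f (fun i => ys`_i - c i *: y0)).
  rewrite mem_cat !mem_iota subnKC //= add0n ltn_ord andbT orbC -neq_ltn.
  by rewrite eq_sym.
have [Fy0 Fzhs] : form y0 /\ forms (zs ++ hs).
  split; first by exists 1%N.
  by apply/forms_cat; split=> //; apply: lines_forms.
have Hzf : forms (y0 :: zs ++ hs) by apply/forms_cons.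
have Hyf : forms (ys ++ hs) by apply/forms_cat; split=> //; apply: lines_forms.
have Ep : y0 :: (ys1 ++ ys2) ++ hs =i ys ++ hs.
  by move=> x; rewrite Eys inE !mem_cat inE !orbA (orbC (x == y0)).
have Rz : regular (y0 :: zs ++ hs).
  apply: regular_pull.
    move=> x; rewrite mem_cat inE orbCA => Hx; apply: Hzf.
    by rewrite inE mem_cat.
  apply: (regular_map (f := fun i => ys`_i)) => [i _|].
    rewrite opprB addrC subrK -mul_mpolyC; apply: idealMl.
    by apply: ideal_mem; rewrite inE eqxx.
  rewrite -Ejs; apply: regular_push; first by move=> x; rewrite Ep; apply: Hyf.
  rewrite -catA; apply: regular_pull.
    by move=> x Hx; apply: Hyf; rewrite Eys -catA.
  by move: Hr; rewrite {1}Eys -catA.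
have Ey : ideal (h :: zs ++ hs) (y0 ^+ T).
  have Hz : ideal zs (eval_at ys D - mmap (@mpolyC n F) (fun i => (l i)%:MP * y0) D).
    apply: mmap_congr => i; case: (eqVneq i i0) => [->|ne].
      by rewrite /l divff // mpolyC1 mul1r subrr; apply: ideal0.
    by rewrite mul_mpolyC -Ec; apply: ideal_mem; apply: Hmem.
  rewrite (homog_mmap_line _ _ _ HD) in Hz.
  rewrite -[y0 ^+ T]mul1r -(mpolyC1 _ F) -(mulVf Hl0) mpolyCM -mulrA.
  apply: idealMl; rewrite -[_ * _](subrK (eval_at ys D)); apply: idealD.
    rewrite -opprB; apply: idealN; apply: ideal_sub Hz => x Hx.
    by rewrite inE mem_cat Hx orbT.
  by apply: ideal_sub HhD => x; rewrite !inE mem_cat => /orP[->|->]; rewrite ?orbT.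
have [Hnz Hrz] := Rz.
(* The exchange: y0 is a nonzerodivisor modulo [zs ++ hs], and there [h] divides a power of it. *)
have Hnh : nzd (zs ++ hs) h by apply: nzd_exchange Hnz _ Ey.
have Hhzf : forms (h :: zs ++ hs) by apply/forms_cons.
have Hhf : forms (h :: hs) by apply/forms_cons.
exists zs => //; split=> //; first by apply: regular_push.
have Hy0h : forms (y0 :: zs ++ h :: hs).
  by apply/forms_cons; split=> //; apply/forms_cat; split=> //; apply: lines_forms.
apply: (exhausted_pow T00 _ Hy0 Hy0h); last first.
  by apply: ideal_sub Ey => x; rewrite inE !mem_cat inE orbCA.
move=> T' p le Hp; apply: ideal_sub (_ : ideal (y0 :: zs ++ hs) p).
  move=> x; rewrite in_cons mem_cat => Hx; rewrite in_cons mem_cat in_cons.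
  by case/or3P: Hx => ->; rewrite ?orbT.
apply: (ideal_sub (hs := [seq ys`_i - c i *: y0 | i <- js] ++ y0 :: hs)).
  by move=> x; rewrite inE !mem_cat inE orbCA.
apply: (eq_ideal_map (f := fun i => ys`_i)) => [i _|].
  rewrite opprB addrC subrK -mul_mpolyC; apply: idealMl.
  by apply: ideal_mem; rewrite inE eqxx.
rewrite -Ejs; apply: ideal_sub (HE _ _ le Hp) => x.
by rewrite -Ep inE !mem_cat inE orbCA.
Qed.

End NormalizationStep.
End Normalization.

(** * Algebraic relations over the parameters, by counting *)

Module Extension.
Import mpoly RegularSequences NonVanishing Normalization.
Import GRing.Theory.
Local Open Scope ring_scope.

(** Finite coordinates for the forms of one degree, so that they can be counted although the
    polynomials do not form a finite type. *)
Lemma homog_param (F : finFieldType) d D :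
  exists f : 'rV[F]_('C(D + d, D)) -> {mpoly F[d.+1]},
    [/\ {morph f : u v / u - v}, injective f, forall u, f u \is D.-homog
      & forall p, p \is D.-homog -> exists u, f u = p].
Proof.
case: (dhomog_vecaxiom d F D) => v2r lin [r2v K1 K2].
have r2vB : {morph r2v : u v / u - v}.
  move=> u v; apply: (can_inj K1); rewrite K2.
  by rewrite -[r2v u - r2v v]addrC -scaleN1r lin !K2 scaleN1r addrC.
exists (fun u => mpoly_of_dhomog (r2v u)); split.
- by move=> u v; rewrite r2vB.
- by move=> u v /val_inj /(can_inj K2).
- by move=> u; case: (r2v u).
by move=> p Hp; exists (v2r (DHomog Hp)); rewrite K1.
Qed.

Section Relation.
Variables (n : nat) (F : finFieldType).
Local Notation R := {mpoly F[n]}.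
Implicit Types (p q r : R) (hs ys : seq R).

Lemma ideal_catP ys hs T p : lines ys -> forms hs -> p \is T.+1.-homog ->
  ideal (ys ++ hs) p ->
  exists r : nat -> R, (forall i, r i \is T.-homog) /\
    ideal hs (p - \sum_(i < size ys) ys`_i * r i).
Proof.
move=> Hl Hf; elim: ys p Hl => [|y ys IH] p Hl Hp /=.
  by exists (fun=> 0); rewrite big_ord0 subr0; split=> // i; apply: rpred0.
move=> H; have Hl' : lines ys by move=> z Hz; apply: Hl; rewrite inE Hz orbT.
have Hy : y \is 1.-homog by apply: Hl; rewrite inE eqxx.
have [|r [H1 H2 _]] := ideal_consP _ Hy Hp H.
  apply/forms_cons; split; first by exists 1%N.
  by apply/forms_cat; split=> //; apply: lines_forms.
have Hr : r \is T.-homog by have := H2 isT; rewrite subn1.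
have Hpr : p - y * r \is T.+1.-homog.
  by apply: rpredB => //; rewrite -add1n; apply: dhomogM.
have [r' [H3 H4]] := IH _ Hl' Hpr H1.
exists (fun i => if i is j.+1 then r' j else r); split; first by case.
by rewrite big_ord_recl /= opprD addrA.
Qed.

(** Below degree [T0] the monomials are the generators; from [T0] on a form is a combination of the
    y_i with coefficients one degree lower, and induction applies to these. *)
Lemma module_generation T0 ys hs d : size ys = d -> (0 < T0)%N -> normalizes T0 ys hs ->
  forall T p, p \is T.-homog ->
  exists c : 'X_{1..n < T0} -> {mpoly F[d]},
    (forall e, c e \is (T - mdeg e).-homog /\ ((T < mdeg e)%N -> c e = 0)) /\
    ideal hs (p - \sum_e eval_at ys (c e) * 'X_[e]).
Proof.
move=> Ed T00 [Hl Hf Hr HE]; elim/ltn_ind => T IH p Hp.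
case: (ltnP T T0) => [lt|le].
  exists (fun e => (p@_e)%:MP); split.
    move=> e; case: (eqVneq (mdeg e) T) => [E|ne].
      rewrite E subnn ltnn; split=> //.
      by rewrite -[_%:MP]mulr1 mul_mpolyC rpredZ // dhomog1.
    rewrite (dhomog_nemf_coeff Hp ne) mpolyC0; split=> //; exact: rpred0.
  have sp : (msize p <= T0)%N.
    rewrite msizeE; apply/bigmax_leqP_seq => m Hm _.
    by have Em : mdeg m = T := dhomog_mf Hp Hm; rewrite Em.
  rewrite {1}(mpolywE sp).
  under [X in _ - X]eq_bigr => e _ do rewrite /eval_at mmapC mul_mpolyC.
  by rewrite subrr; apply: ideal0.
case: T IH Hp le => [|T] IH Hp le; first by move: le; rewrite leqNgt T00.
have [r [H1 H2]] := ideal_catP Hl Hf Hp (HE _ _ le Hp).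
have /fin_all_exists [c Hc] : forall i : 'I_d, exists c : 'X_{1..n < T0} -> {mpoly F[d]},
    (forall e, c e \is (T - mdeg e).-homog /\ ((T < mdeg e)%N -> c e = 0)) /\
    ideal hs (r i - \sum_e eval_at ys (c e) * 'X_[e]).
  by move=> i; apply: IH.
exists (fun e => \sum_i 'X_i * c i e); split.
  move=> e; split.
    apply: rpred_sum => i _; have [Hi1 Hi2] := (Hc i).1 e.
    case: (leqP (mdeg e) T) => [leT|/Hi2 ->]; last by rewrite mulr0 rpred0.
    by rewrite subSn // -add1n; apply: dhomogM => //; rewrite dhomogX; apply/eqP/mdeg1.
  move=> lt; rewrite big1 // => i _.
  by rewrite ((Hc i).1 e).2 ?mulr0 // ltnW.
rewrite Ed in H2; set A := \sum_(i < d) _ in H2; set S := \sum_e _.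
rewrite -[p](subrK A) -addrA; apply: idealD => //; rewrite /A /S {A S H2}.
rewrite (_ : \sum_e _ = \sum_(i < d) ys`_i * \sum_e eval_at ys (c i e) * 'X_[e]).
  by rewrite -sumrB; apply: ideal_sum => i _; rewrite -mulrBr; apply/idealMl/(Hc i).2.
under [RHS]eq_bigr => i _ do rewrite mulr_sumr.
rewrite exchange_big; apply: eq_bigr => e _.
rewrite /eval_at rmorph_sum mulr_suml; apply: eq_bigr => i _ /=.
by rewrite rmorphM /= mmapX mmap1U mulrA.
Qed.

(* Pigeonhole: the combinations of 1, h, ..., h^N outnumber the coefficient
   vectors on the module generators, so two of them agree modulo the ideal. *)
Lemma relation T0 ys hs d k N D T (h : R) :
  size ys = d.+1 -> (0 < T0)%N -> normalizes T0 ys hs -> h \is k.-homog ->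
  N = #|{: 'X_{1..n < T0}}| -> T = (D + N * k)%N ->
  (N * 'C(T + d, T) < N.+1 * 'C(D + d, D))%N ->
  exists Q : {poly {mpoly F[d.+1]}},
    [/\ Q != 0, (size Q <= N.+1)%N,
        forall i, (i <= N)%N -> Q`_i \is (T - i * k).-homog
      & ideal hs (map_poly (@eval_at n F ys d.+1) Q).[h]].
Proof.
move=> Ed T00 HN Hh EN ET Hlt.
have [f [fB finj fhom _]] := homog_param F d D.
have [g [gB ginj ghom gsurj]] := homog_param F d T.
pose x0 : {mpoly F[d.+1]} := 'X_ord0.
have x0_hom e : x0 ^+ e \is e.-homog.
  by rewrite -{2}[e]mul1n; apply: dhomogMn; rewrite dhomogX; apply/eqP/mdeg1.
have x0_neq0 e : x0 ^+ e != 0.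
  by rewrite expf_neq0 // -msupp_eq0 msuppX.
(* Padding with powers of one variable gives each coefficient the same number 'C(D + d, D) of free
   parameters while all terms of the combination have degree T. *)
pose coef (b : {ffun 'I_N.+1 -> 'rV[F]_('C(D + d, D))}) (i : 'I_N.+1) :=
  x0 ^+ ((N - i) * k) * f (b i).
have coef_hom b i : coef b i \is (T - i * k).-homog.
  have -> : (T - i * k = (N - i) * k + D)%N.
    by rewrite ET mulnBl [RHS]addnC addnBA // leq_mul2r -ltnS ltn_ord orbT.
  exact: dhomogM.
pose S b := \sum_(i < N.+1) eval_at ys (coef b i) * h ^+ i.
have S_hom b : S b \is T.-homog.
  apply: rpred_sum => i _.
  have lei : (i * k <= T)%N.
    rewrite ET; apply: leq_trans (leq_addl _ _).
    by rewrite leq_mul2r -ltnS ltn_ord orbT.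
  have <- : (T - i * k + k * i = T)%N by rewrite [(k * i)%N]mulnC subnK.
  apply: dhomogM; last exact: dhomogMn.
  rewrite -[(T - _)%N]mul1n; apply: homog_mmap => // j.
  by case: HN => Hl _ _ _; apply/Hl/mem_nth; rewrite Ed.
(* The same padding brings all module coordinates to degree T, where they are counted uniformly; the
   power of x0 is cancelled again below. *)
have /fin_all_exists [w Hw] : forall b, exists w : {ffun 'X_{1..n < T0} -> 'rV[F]_('C(T + d, T))},
    exists c : 'X_{1..n < T0} -> {mpoly F[d.+1]},
    (forall e, g (w e) = x0 ^+ mdeg e * c e) /\
    ideal hs (S b - \sum_e eval_at ys (c e) * 'X_[e]).
  move=> b; have [c [Hc1 Hc2]] := module_generation Ed T00 HN (S_hom b).
  have /fin_all_exists [w Hw] : forall e : 'X_{1..n < T0}, exists u, g u = x0 ^+ mdeg e * c e.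
    move=> e; apply: gsurj; have [C1 C2] := Hc1 e.
    case: (leqP (mdeg e) T) => [le|/C2 ->]; last by rewrite mulr0 rpred0.
    by have := dhomogM (x0_hom (mdeg e)) C1; rewrite subnKC.
  exists [ffun e => w e]; exists c; split=> // e; first by rewrite ffunE.
have [b [b' [ne Ew]]] : exists b, exists b', b != b' /\ w b = w b'.
  have : ~~ injectiveb w.
    apply/injectiveP => /leq_card; rewrite !card_ffun card_ord !card_mx !mul1n -EN -!expnM.
    by rewrite leq_exp2l ?finNzRing_gt1 // leqNgt mulnC [('C(D + d, D) * _)%N]mulnC Hlt.
  by case/injectivePn => b [b' ne E]; exists b; exists b'.
have [c [Hc1 Hc2]] := Hw b; have [c' [Hc1' Hc2']] := Hw b'.
have Ec e : c e = c' e.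
  by apply: (mulfI (x0_neq0 (mdeg e))); rewrite -Hc1 -Hc1' Ew.
pose Q : {poly {mpoly F[d.+1]}} := \poly_(i < N.+1) (coef b (inord i) - coef b' (inord i)).
have EQ i : (i <= N)%N -> Q`_i = coef b (inord i) - coef b' (inord i).
  by rewrite coef_poly -ltnS => ->.
exists Q; split.
- apply/eqP => Q0; case/eqP: ne; apply/ffunP => i.
  have := EQ i; rewrite -ltnS ltn_ord Q0 coef0 inord_val /coef -mulrBr => /(_ isT)/esym/eqP.
  by rewrite mulf_eq0 (negbTE (x0_neq0 _)) /= subr_eq0 => /eqP/finj.
- exact: size_poly.
- move=> i le; have Hi b0 : coef b0 (inord i) \is (T - i * k).-homog.
    by have := coef_hom b0 (inord i); rewrite inordK ?ltnS.
  by rewrite EQ //; apply: rpredB; apply: Hi.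
have -> : (map_poly (@eval_at n F ys d.+1) Q).[h] = S b - S b'.
  have sQ : (size (map_poly (@eval_at n F ys d.+1) Q) <= N.+1)%N.
    exact: leq_trans (size_poly _ _) (size_poly _ _).
  rewrite (horner_coef_wide _ sQ) -sumrB; apply: eq_bigr => i _.
  rewrite coef_map_id0; last by rewrite /eval_at mmap0.
  have Hi : (i <= N)%N by rewrite -ltnS.
  by rewrite (EQ i Hi) inord_val /eval_at mmapB mulrBl.
pose A := \sum_e eval_at ys (c e) * 'X_[e].
have EA : \sum_e eval_at ys (c' e) * 'X_[e] = A by apply: eq_bigr => e _; rewrite Ec.
rewrite EA in Hc2'; have -> : S b - S b' = (S b - A) - (S b' - A).
  by rewrite opprB addrA subrK.
exact: idealB.
Qed.

End Relation.
End Extension.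

(** * Few forms fail to extend a regular sequence *)

Module Avoidance.
Import mpoly RegularSequences NonVanishing Normalization Extension.
Import GRing.Theory.

(** The ratio of the two binomials is a product of d factors 1 + a/(D + i), at most 1/(1 - da/D);
    here with denominators cleared. *)
Lemma leq_bin_shift D a d : d * a <= D ->
  'C(D + a + d, d) * (D - d * a) <= D * 'C(D + d, d).
Proof.
elim: d => [|d IH] le; first by rewrite !bin0 mul0n subn0 mul1n muln1.
have le' : d * a <= D by apply: leq_trans le; rewrite leq_mul2r leqnSn orbT.
have {IH} := IH le'.
have EX := mul_bin_diag (D + a + d).+1 d; have EY := mul_bin_diag (D + d).+1 d.
rewrite /= -!addnS in EX EY.
set X := 'C(D + a + d, d) in EX *; set Y := 'C(D + d, d) in EY *.
set X' := 'C(_, d.+1) in EX *; set Y' := 'C(_, d.+1) in EY *.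
have -> : D - d * a = (D - d.+1 * a) + a by rewrite mulSn in le *; lia.
set E := D - d.+1 * a; have leE : E <= D by apply: leq_subr.
move=> H; rewrite -(leq_pmul2l (ltn0Sn d)).
have K : (D + a + d.+1) * E <= (D + d.+1) * (E + a) by nia.
have K' : X * ((D + a + d.+1) * E) <= X * ((D + d.+1) * (E + a)) by rewrite leq_mul2l K orbT.
have K'' : (D + d.+1) * (X * (E + a)) <= (D + d.+1) * (D * Y) by rewrite leq_mul2l H orbT.
rewrite (_ : d.+1 * (X' * E) = X * ((D + a + d.+1) * E)); last by rewrite mulnA -EX; lia.
rewrite (_ : d.+1 * (D * Y') = (D + d.+1) * (D * Y)); last by rewrite mulnCA -EY; lia.
by apply: leq_trans K' _; rewrite mulnCA.
Qed.

(** For large D a shift by a changes the dimension by a factor below (N + 1)/N. This closes both the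
    pigeonhole in [relation] and the asymptotic comparison in [bezout]. *)
Lemma ltn_bin_shift N a d D : N.+1 * (d * a) < D ->
  N * 'C(D + a + d, d) < N.+1 * 'C(D + d, d).
Proof.
move=> lt; have le : d * a <= D.
  by apply: leq_trans (ltnW lt); apply: leq_pmull.
have := leq_bin_shift le.
set X := 'C(D + a + d, d); set Y := 'C(D + d, d) => H.
have D0 : 0 < D by apply: leq_ltn_trans lt.
have Y0 : 0 < Y by rewrite bin_gt0 leq_addl.
have X0 : 0 < X by rewrite bin_gt0 leq_addl.
rewrite -(ltn_pmul2l D0) [X in _ < X]mulnCA.
have lt' : N * D < N.+1 * (D - d * a) by rewrite mulnBr; nia.
have K : X * (N * D) < X * (N.+1 * (D - d * a)) by rewrite ltn_pmul2l.
have K' : N.+1 * (X * (D - d * a)) <= N.+1 * (D * Y) by rewrite leq_mul2l H orbT.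
rewrite (_ : D * (N * X) = X * (N * D)); last by lia.
by apply: (leq_trans K); rewrite mulnCA.
Qed.

Local Open Scope ring_scope.

Section ExtensionCount.
Variables (n' : nat) (F : finFieldType).
Local Notation n := n'.+1.
Local Notation q := #|F|.
Local Notation R := {mpoly F[n]}.
Implicit Types (p : R) (hs ys : seq R).

(** The number of parameters is complementary to the length of [hs], so each form of the sequence
    lowers the dimension by one. *)
Definition good T0 hs := exists2 ys, (size ys + size hs = n)%N & normalizes T0 ys hs.

Definition nmon T0 := #|{: 'X_{1..n < T0}}|.

(* Large enough for the pigeonhole count of [relation], by [ltn_bin_shift]. *)
Definition rel_deg T0 k :=
  let N := nmon T0 in ((N.+1 * (n * (N * k))).+1 + N * k)%N.

Lemma horner_diff (A : comNzRingType) (p : {poly A}) x y :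
  exists r, p.[x] - p.[y] = (x - y) * r.
Proof.
elim/poly_ind: p => [|p c [r IH]]; first by exists 0; rewrite !horner0 subrr mulr0.
exists (r * x + p.[y]); rewrite !hornerE mulrDr mulrA -IH.
ring.
Qed.

Lemma horner_eval_at ys d (Q : {poly {mpoly F[d]}}) c :
  (map_poly (@eval_at n F ys d) Q).[eval_at ys c] = eval_at ys Q.[c].
Proof.
exact: (horner_map (mmap (@mpolyC n F) (fun i : 'I_d => ys`_i) : {rmorphism _ -> _})).
Qed.

(* If Q is the relation satisfied by h, then Q(-p) is a multiple of h + p modulo
   the ideal, so h + p extends the sequence unless -p is a root of Q. *)
Lemma extension_count T0 hs d k : good T0 hs -> (0 < T0)%N -> (0 < k)%N ->
  (size hs + d = n')%N -> (rel_deg T0 k < q)%N ->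
  exists e : 'rV[F]_('C(k + d, k)) -> R, (forall u, e u \is k.-homog) /\
    forall h, h \is k.-homog -> exists B : {set 'rV[F]_('C(k + d, k))},
      (#|B| <= nmon T0)%N /\
      forall u, u \notin B -> good (T0 + rel_deg T0 k) (h + e u :: hs).
Proof.
move=> [ys Sys HN] T00 k0 Ed ltq.
have Eys : size ys = d.+1 by apply/eqP; move: Sys Ed; lia.
have [f [fB finj fhom _]] := homog_param F d k.
have [Hl Hf _ _] := HN.
exists (fun u => eval_at ys (f u)); split.
  move=> u; rewrite -[k]mul1n; apply: homog_mmap => // j.
  by apply/Hl/mem_nth; rewrite Eys.
move=> h Hh; set N := nmon T0; pose D := (N.+1 * (n * (N * k))).+1.
pose T := (D + N * k)%N.
have ET : rel_deg T0 k = T by [].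
have Hbin : (N * 'C(T + d, T) < N.+1 * 'C(D + d, D))%N.
  rewrite -(bin_sub (leq_addr d T)) -(bin_sub (leq_addr d D)) !addKn.
  apply: ltn_bin_shift; rewrite ltnS leq_mul2l leq_mul2r; apply/orP; right.
  by apply/orP; right; lia.
have [Q [Q0 sQ HQ HQh]] := relation Eys T00 HN Hh (erefl : N = _) (erefl : T = _) Hbin.
exists [set u | root Q (- f u)]; split.
  have Hu : uniq [seq - f u | u <- enum [set u | root Q (- f u)]].
    by rewrite map_inj_uniq ?enum_uniq // => u v /oppr_inj/finj.
  have Hr : all (root Q) [seq - f u | u <- enum [set u | root Q (- f u)]].
    by apply/allP => x /mapP[u]; rewrite mem_enum inE => Hu' ->.
  have := max_poly_roots Q0 Hr Hu; rewrite size_map -cardE => /leq_trans/(_ sQ).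
  by rewrite ltnS.
move=> u; rewrite inE => Hu.
have DH : Q.[- f u] \is T.-homog.
  rewrite (horner_coef_wide _ sQ); apply: rpred_sum => i _.
  have lei : (i * k <= T)%N.
    by apply: leq_trans (leq_addl _ _); rewrite leq_mul2r -ltnS ltn_ord orbT.
  have <- : (T - i * k + k * i = T)%N by rewrite [(k * i)%N]mulnC subnK.
  apply: dhomogM; first by apply: HQ; rewrite -ltnS.
  by apply: dhomogMn; rewrite rpredN; apply: fhom.
have DI : ideal (h + eval_at ys (f u) :: hs) (eval_at ys Q.[- f u]).
  have [r Er] := horner_diff (map_poly (@eval_at n F ys d.+1) Q) h (- eval_at ys (f u)).
  exists (- r); rewrite mulrN opprK -horner_eval_at.
  have <- : - eval_at ys (f u) = eval_at ys (- f u) by rewrite /eval_at mmapN.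
  by rewrite opprK in Er; rewrite -Er addrC subrK.
have Fh : form (h + eval_at ys (f u)).
  exists k => //; apply: rpredD => //.
  rewrite -[k]mul1n; apply: homog_mmap => // j.
  by apply/Hl/mem_nth; rewrite Eys.
have T_bd : (0 < T < q)%N by rewrite -ET ltq andbT ET.
have [ys' Sys' HN'] := normalizes_cons Eys T00 HN Fh Hu DH T_bd DI.
exists ys' => //=; move: Sys' Sys; rewrite Eys; lia.
Qed.
End ExtensionCount.
End Avoidance.

(** * One form that extends many sequences at once *)

Module GenericForms.
Import mpoly RegularSequences NonVanishing Normalization Extension Avoidance.
Import GRing.Theory.
Local Open Scope ring_scope.

(** Double counting of the pairs (h, u) with h + e u bad: as translation is a bijection, each u
    contributes #|bad|. *)
Lemma card_translates (V : finZmodType) (W : finType) (e : W -> V)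
    (bad : {set V}) (N : nat) :
  (forall h, (#|[set u | (h + e u)%R \in bad]| <= N)%N) ->
  (#|bad| * #|W| <= N * #|V|)%N.
Proof.
move=> H.
have <- : (\sum_(h : V) #|[set u | (h + e u)%R \in bad]| = #|bad| * #|W|)%N.
  under eq_bigr => h _ do rewrite cardsE -sum1_card big_mkcond /=.
  rewrite exchange_big /= (eq_bigr (fun=> #|bad|)) ?sum_nat_const 1?mulnC // => u _.
  rewrite -big_mkcond /= -sum1_card (reindex_inj (addIr (- e u))) /=.
  by apply: eq_bigl => h; rewrite unfold_in subrK.
apply: (@leq_trans (\sum_(h : V) N)%N); first by apply: leq_sum => h _; apply: H.
by rewrite sum_nat_const mulnC.
Qed.

Lemma card_big_setU (T : finType) (I : Type) (s : seq I) (A : I -> {set T}) :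
  (#|\bigcup_(i <- s) A i| <= \sum_(i <- s) #|A i|)%N.
Proof.
elim: s => [|i s IH]; first by rewrite !big_nil cards0.
by rewrite !big_cons (leq_trans (leq_card_setU _ _)) // leq_add2l.
Qed.

(** The value of [T0] after j extensions by forms of degree at most K. It depends neither on the
    forms nor on the field, so the size required of q is known in advance. *)
Fixpoint tau n' K j := if j is j'.+1 then
  (tau n' K j' + rel_deg n' (tau n' K j') K)%N else 1%N.

Definition bounded_by n' q K Bnd := forall j, (j <= n')%N ->
  (nmon n' (tau n' K j) <= Bnd)%N /\ (rel_deg n' (tau n' K j) K < q)%N.

Lemma tau_gt0 n' K j : (0 < tau n' K j)%N.
Proof. by elim: j => //= j IH; rewrite addn_gt0 IH. Qed.

Lemma leq_rel_deg n' T0 k K : (k <= K)%N -> (rel_deg n' T0 k <= rel_deg n' T0 K)%N.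
Proof.
move=> le; rewrite /rel_deg; set N := nmon _ _.
have H : (N * k <= N * K)%N by rewrite leq_mul2l le orbT.
by rewrite leq_add // ltnS !leq_mul.
Qed.

Lemma good_le n' (F : finFieldType) T0 T1 (hs : seq {mpoly F[n'.+1]}) :
  (T0 <= T1)%N -> good T0 hs -> good T1 hs.
Proof.
move=> le [ys Sys [H1 H2 H3 H4]]; exists ys => //; split=> // T p leT.
by apply: H4; apply: leq_trans le leT.
Qed.

Section Avoid.
Variables (n' : nat) (F : finFieldType).
Local Notation n := n'.+1.
Local Notation q := #|F|.
Local Notation R := {mpoly F[n]}.
Implicit Types (hs ys : seq R).

(** A union bound over the sequences in [U] and over all q constants a: the popular constant is
    known only once h has been fixed, so every shift of h must be good. [cmin] bounds from below the
    dimension of the cosets on which bad forms are counted. *)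
Lemma avoid (U : seq (seq R)) K Bnd k cmin (x0 : R) :
  bounded_by n' q K Bnd -> (0 < k <= K)%N -> x0 \is 1.-homog ->
  (forall hs, hs \in U -> good (tau n' K (size hs)) hs /\
     exists d, (size hs + d = n')%N /\ (cmin <= 'C(k + d, k))%N) ->
  (size U * (q * Bnd) < q ^ cmin)%N ->
  exists2 h, h \is k.-homog & forall hs (a : F), hs \in U ->
    good (tau n' K (size hs).+1) (h - a *: x0 ^+ k :: hs).
Proof.
move=> HB /andP[k0 kK] Hx0 HU Hsz.
have [f [fB finj fhom fsurj]] := homog_param F n' k.
set V := 'rV[F]_('C(k + n', k)) in f fB finj fhom fsurj.
have fD : {morph f : u v / u + v}.
  have f0 : f 0 = 0 by rewrite -(subrr 0) fB subrr.
  have fN v : f (- v) = - f v by rewrite -[in LHS]sub0r fB f0 sub0r.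
  by move=> u v; rewrite -{1}[v]opprK fB fN opprK.
have Hxk a : a *: x0 ^+ k \is k.-homog.
  by apply: rpredZ; have := dhomogMn k Hx0; rewrite mul1n.
pose bad hs a : {set V} := [set u | boolp.asbool (~ good (tau n' K (size hs).+1) (f u - a *: x0 ^+ k :: hs))].
have Hbad hs a : hs \in U -> (#|bad hs a| * q ^ cmin <= Bnd * #|V|)%N.
  move=> /HU [Hg [d [Ed lec]]].
  have les : (size hs <= n')%N by apply: leq_trans (leq_addr d _) _; rewrite Ed.
  have [leB ltq] := HB _ les.
  have [e [e_hom He]] := extension_count Hg (tau_gt0 _ _ _) k0 Ed (leq_ltn_trans (leq_rel_deg _ _ kK) ltq).
  have /fin_all_exists [e' He'] : forall u, exists v, f v = e u.
    by move=> u; apply/fsurj/e_hom.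
  apply: leq_trans (_ : #|bad hs a| * #|'rV[F]_('C(k + d, k))| <= _)%N.
    by rewrite leq_mul2l card_mx mul1n leq_exp2l ?finNzRing_gt1 // lec orbT.
  apply: leq_trans (leq_mul leB (leqnn _)).
  apply: (card_translates (e := e')) => h.
  have [|B [HB1 HB2]] := He (f h - a *: x0 ^+ k).
    exact: (rpredB (fhom h) (Hxk a)).
  apply: leq_trans HB1; apply/subset_leq_card/subsetP => u.
  rewrite !inE => /boolp.asboolP; apply: contra_notT => /HB2.
  rewrite fD He' addrAC; apply: good_le; rewrite /= leq_add2l; exact: leq_rel_deg.
pose all_bad := \bigcup_(hs <- U) \bigcup_a bad hs a.
have Hall : (#|all_bad| < #|V|)%N.
  have q0 : (0 < q ^ cmin)%N by rewrite expn_gt0 (ltn_trans _ (finNzRing_gt1 F)).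
  have V0 : (0 < #|V|)%N by apply/card_gt0P; exists 0.
  have le1 : (#|all_bad| <= \sum_(hs <- U) \sum_a #|bad hs a|)%N.
    rewrite /all_bad.
    apply: leq_trans (_ : \sum_(hs <- U) #|\bigcup_a bad hs a| <= _)%N.
      exact: card_big_setU.
    apply: leq_sum => hs _.
    by apply: card_big_setU.
  rewrite -(ltn_pmul2r q0).
  apply: leq_ltn_trans (_ : size U * (q * (Bnd * #|V|)) < _)%N; last first.
    by rewrite [X in (_ < X)%N]mulnC !mulnA ltn_pmul2r // -mulnA.
  apply: leq_trans (leq_mul le1 (leqnn _)) _.
  rewrite big_distrl /= big_seq.
  apply: leq_trans (_ : \sum_(hs <- U | hs \in U) q * (Bnd * #|V|) <= _)%N.
    apply: leq_sum => hs Hhs; rewrite big_distrl /=.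
    apply: (@leq_trans (\sum_(a : F) (Bnd * #|V|))%N); last by rewrite sum_nat_const.
    by apply: leq_sum => a _; apply: Hbad.
  by rewrite -big_seq big_const_seq count_predT iter_addn_0 mulnC.
have [u Hu] : exists u, u \notin all_bad.
  apply/existsP; move: Hall; apply: contraTT; rewrite negb_exists => /forallP H.
  rewrite -leqNgt -cardsT; apply/subset_leq_card/subsetP => u _.
  by move: (H u); rewrite negbK.
exists (f u) => [|hs a Hhs]; first exact: fhom.
apply: boolp.contrapT => Hn; move/negP: Hu; apply.
rewrite /all_bad (big_rem hs) //= inE; apply/orP; left.
by apply/bigcupP; exists a => //; rewrite inE; apply/boolp.asboolP.
Qed.
End Avoid.
End GenericForms.

(** * Bezout's inequality through Hilbert functions *)

Module Bezout.
Import mpoly RegularSequences NonVanishing Normalization Extension Avoidance.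
Import GRing.Theory.

Lemma leq_bin_sub r d T : d <= T ->
  'C(T + r.+1, r.+1) <= 'C(T - d + r.+1, r.+1) + d * 'C(T + r, r).
Proof.
elim: d => [|d IH] le; first by rewrite subn0 leq_addr.
apply: leq_trans (IH (ltnW le)) _.
have -> : T - d = (T - d.+1).+1 by lia.
have le' : 'C(T - d.+1 + r.+1, r) <= 'C(T + r, r) by apply: leq_bin2l; lia.
rewrite addSn binS mulSn; lia.
Qed.

Lemma leq_bin_succ r T : 'C(T + r.+1, r.+1) <= T.+1 * 'C(T + r, r).
Proof.
elim: T => [|T IH]; first by rewrite !add0n !binn.
have le' : T.+1 * 'C(T + r, r) <= T.+1 * 'C(T.+1 + r, r).
  by rewrite leq_mul2l; apply: leq_bin2l; lia.
rewrite addSn binS [X in _ <= X]mulSn -addSnnS in IH *.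
rewrite addSn in IH le' *; lia.
Qed.

Local Open Scope ring_scope.

Section Bezout.
Variables (n' : nat) (F : finFieldType).
Local Notation n := n'.+1.
Local Notation q := #|F|.
Local Notation R := {mpoly F[n]}.
Implicit Types (hs ys : seq R).

(** States that the Hilbert function of the quotient is at least N in degree T. *)
Definition independent hs T N := exists e : 'I_N -> R,
  (forall i, e i \is T.-homog) /\
  forall c : 'I_N -> F, ideal hs (\sum_i c i *: e i) -> forall i, c i = 0.

Lemma independent_tail h hs T N : independent (h :: hs) T N -> independent hs T N.
Proof.
by move=> [e [H1 H2]]; exists e; split=> // c Hc; apply: H2; apply: ideal_tail.
Qed.

(** The exact sequence 0 -> (R/I)(-d) -> R/I -> R/(I, h) -> 0, in which multiplication by h is
    injective by [nzd]: lower bounds for the Hilbert functions of the outer terms add up. *)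
Lemma independent_cons h hs d T N1 N2 : h \is d.-homog -> nzd hs h -> (d <= T)%N ->
  independent (h :: hs) T N1 -> independent hs (T - d) N2 ->
  independent hs T (N1 + N2).
Proof.
move=> Hh Hn le [e1 [H1 I1]] [e2 [H2 I2]].
exists (fun i => match split i with inl j => e1 j | inr j => h * e2 j end); split.
  move=> i; case: (split i) => j //.
  by rewrite -(subnKC le); apply: dhomogM.
move=> c; rewrite big_split_ord /=.
under eq_bigr => i _ do rewrite (unsplitK (inl i)).
under [X in _ + X]eq_bigr => i _ do rewrite (unsplitK (inr i)).
set A := \sum_i _.
have -> : \sum_(i < N2) c (rshift N1 i) *: (h * e2 i) =
          h * \sum_(i < N2) c (rshift N1 i) *: e2 i.
  by rewrite mulr_sumr; apply: eq_bigr => i _; rewrite scalerAr.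
set B := \sum_i _ => HAB.
have C1 i : c (lshift N2 i) = 0.
  by apply: (I1 (fun i => c (lshift N2 i))); exists (- B); rewrite mulrN opprK.
have A0 : A = 0 by rewrite /A big1 // => i _; rewrite C1 scale0r.
have C2 i : c (rshift N1 i) = 0.
  apply: (I2 (fun i => c (rshift N1 i))); apply: (Hn (T - d)%N).
    by apply: rpred_sum => j _; apply: rpredZ; apply: H2.
  by move: HAB; rewrite A0 add0r.
by move=> i; rewrite -(splitK i); case: (split i) => j /=.
Qed.

Lemma independent_bound T N : independent [::] T N -> (N <= 'C(T + n', T))%N.
Proof.
move=> [e [H I]].
have [f [fB finj fhom fsurj]] := homog_param F n' T.
have /fin_all_exists [w Hw] : forall c : {ffun 'I_N -> F}, exists u,
    f u = \sum_i c i *: e i.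
  by move=> c; apply: fsurj; apply: rpred_sum => i _; apply: rpredZ; apply: H.
have winj : injective w.
  move=> c c' E; apply/ffunP => i; apply/eqP; rewrite -subr_eq0; apply/eqP.
  apply: (I (fun i => c i - c' i)) => /=.
  under eq_bigr => j _ do rewrite scalerBl.
  by rewrite sumrB -!Hw E subrr.
have := leq_card w winj; rewrite card_ffun card_ord card_mx mul1n.
by rewrite leq_exp2l ?finNzRing_gt1.
Qed.

Definition affine_point (x : 'I_n' -> F) (i : 'I_n) : F :=
  if unlift ord0 i is Some j then x j else 1.

Lemma affine_point0 x : affine_point x ord0 = 1.
Proof. by rewrite /affine_point unlift_none. Qed.

Lemma affine_pointS x j : affine_point x (lift ord0 j) = x j.
Proof. by rewrite /affine_point liftK. Qed.

(** The product of the 1 - (X_j - x_j)^(q-1) is 1 at x and 0 at every other point of the affine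
    space. Homogenized and multiplied by x0^T, these indicators are independent modulo every ideal
    that vanishes on X. *)
Lemma independent_points hs (X : {set {ffun 'I_n' -> F}}) T :
  (forall h x, h \in hs -> x \in X -> h.@[affine_point x] = 0) ->
  independent hs (n' * q.-1 + T) #|X|.
Proof.
move=> HX; pose x0 : R := 'X_ord0.
have Hx i : ('X_i : R) \is 1.-homog by rewrite dhomogX; apply/eqP/mdeg1.
pose v (x : {ffun 'I_n' -> F}) : R :=
  (\prod_(j < n') (x0 ^+ q.-1 - ('X_(lift ord0 j) - x j *: x0) ^+ q.-1)) * x0 ^+ T.
have q1 : (0 < q.-1)%N by rewrite -subn1 subn_gt0 finNzRing_gt1.
have vhom x : v x \is (n' * q.-1 + T).-homog.
  apply: dhomogM; last by have := dhomogMn T (Hx ord0); rewrite mul1n.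
  have -> : (n' * q.-1 = \sum_(j < n') q.-1)%N by rewrite sum_nat_const card_ord.
  apply: (big_ind2 (fun (p : R) e => p \is e.-homog)) => [|p1 e1 p2 e2|j _].
  - exact: dhomog1.
  - exact: dhomogM.
  have H1 : x0 ^+ q.-1 \is (q.-1).-homog.
    by have := dhomogMn q.-1 (Hx ord0); rewrite mul1n.
  have H2 : ('X_(lift ord0 j) - x j *: x0) \is 1.-homog.
    by apply: rpredB; [apply: Hx|apply/rpredZ/Hx].
  by apply: rpredB => //; have := dhomogMn q.-1 H2; rewrite mul1n.
have veval x (y : {ffun 'I_n' -> F}) : (v x).@[affine_point y] = (x == y)%:R.
  rewrite mevalM rmorph_prod /= rmorphXn /= mevalXU affine_point0 expr1n mulr1.
  case: (eqVneq x y) => [->|ne].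
    rewrite big1 // => j _; rewrite mevalB !rmorphXn /= mevalXU affine_point0 expr1n.
    rewrite mevalB mevalZ !mevalXU affine_point0 affine_pointS mulr1 subrr.
    by rewrite expr0n eqn0Ngt q1 subr0.
  have [j Hj] : exists j, x j != y j.
    apply/existsP; move: ne; apply: contraNT; rewrite negb_exists => /forallP E.
    by apply/eqP/ffunP => j; apply/eqP; move: (E j); rewrite negbK.
  rewrite (bigD1 j) //= mevalB !rmorphXn /= mevalXU affine_point0 expr1n.
  rewrite mevalB mevalZ !mevalXU affine_point0 affine_pointS mulr1.
  have nz : y j - x j != 0 by rewrite subr_eq0 eq_sym.
  suff -> : (y j - x j) ^+ q.-1 = 1 by rewrite subrr mul0r.
  apply: (mulfI nz); rewrite -exprS prednK ?mulr1 ?expf_card //.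
  exact: (ltn_trans _ (finNzRing_gt1 F)).
exists (fun i => v (enum_val i)); split=> // c Hc i.
have : (\sum_i c i *: v (enum_val i)).@[affine_point (enum_val i)] = 0.
  apply: (ideal_rmorph (phi := meval (affine_point (enum_val i))) _ Hc) => h Hh.
  by apply: HX => //; apply: enum_valP.
rewrite (big_morph _ (mevalD _) (meval0 _)) (bigD1 i) //= mevalZ veval eqxx mulr1 big1 ?addr0 // => j ne.
by rewrite mevalZ veval (inj_eq enum_val_inj) (negbTE ne) mulr0.
Qed.

(** Removing a form of degree d adds up the lower bounds at T, T - d, T - 2d and so on. This raises
    the lower index of the binomial by one at the cost of a factor d. *)
Lemma independent_growth (X : {set {ffun 'I_n' -> F}}) (top : seq (nat * R)) base :
  (forall x, x \in top -> (0 < x.1)%N /\ x.2 \is (x.1).-homog) ->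
  (forall h x, h \in map snd top ++ base -> x \in X -> h.@[affine_point x] = 0) ->
  regular (map snd top ++ base) -> forall T,
  exists2 N, independent base (n' * q.-1 + T) N &
    (#|X| * 'C(T + size top, size top) <= N * \prod_(x <- top) x.1)%N.
Proof.
elim/last_ind: top base => [|top [d h] IH] base Htop HX Hr.
  move=> T; exists #|X|; first exact: independent_points.
  by rewrite addn0 bin0 big_nil.
rewrite map_rcons cat_rcons /= in HX Hr.
have [d0 Hh] : (0 < d)%N /\ h \is d.-homog.
  by apply: (Htop (d, h)); rewrite mem_rcons inE eqxx.
have Hnz : nzd base h.
  by elim: (map snd top) Hr => [|g l IHl] /= [].
have {}IH T : exists2 N, independent (h :: base) (n' * q.-1 + T) N &
    (#|X| * 'C(T + size top, size top) <= N * \prod_(x <- top) x.1)%N.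
  by apply: IH => // x Hx; apply: Htop; rewrite mem_rcons inE Hx orbT.
rewrite size_rcons big_rcons /=; set P := (\prod_(_ <- _) _)%N in IH *.
elim/ltn_ind => T IHT; have [N1 HN1 HP1] := IH T.
set r := size top in HP1 IHT *.
case: (leqP d T) => [le|lt].
  have [|N2 HN2 HP2] := IHT (T - d)%N; first by lia.
  exists (N1 + N2)%N.
    apply: (independent_cons Hh Hnz _ HN1).
      by apply: leq_trans le (leq_addl _ _).
    by rewrite -addnBA.
  apply: (@leq_trans (#|X| * ('C(T - d + r.+1, r.+1) + d * 'C(T + r, r)))%N).
    by rewrite leq_mul2l leq_bin_sub ?orbT.
  rewrite mulnDr mulnDl [X in (_ <= X)%N]addnC; apply: leq_add => //.
  by rewrite mulnCA (mulnC P) (mulnCA N1) leq_mul2l HP1 orbT.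
(* For T < d a single term is left, and 'C(T + r + 1, r + 1) is at most T + 1 <= d times 'C(T + r,
   r). *)
exists N1; first exact: independent_tail HN1.
apply: (@leq_trans (#|X| * (d * 'C(T + r, r)))%N).
  rewrite leq_mul2l; apply/orP; right; apply: leq_trans (leq_bin_succ _ _) _.
  by rewrite leq_mul2r lt orbT.
by rewrite mulnCA (mulnC P) (mulnCA N1) leq_mul2l HP1 orbT.
Qed.

(* Bezout: compare [#|X| * 'C(T + n', n')] independent elements, up to the
   factor [\prod deg], with the dimension of the forms of degree [T1 + T]
   and let [T] grow. *)
Lemma bezout (X : {set {ffun 'I_n' -> F}}) (hs : seq (nat * R)) :
  (forall x, x \in hs -> (0 < x.1)%N /\ x.2 \is (x.1).-homog) ->
  (forall h x, h \in map snd hs -> x \in X -> h.@[affine_point x] = 0) ->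
  regular (map snd hs) -> size hs = n' ->
  (#|X| <= \prod_(x <- hs) x.1)%N.
Proof.
move=> Hhs HX Hr Hsz; set P := (\prod_(_ <- _) _)%N; rewrite leqNgt; apply/negP => lt.
set T1 := (n' * q.-1)%N; pose D := (P.+1 * (n' * T1)).+1.
have [|||N HN HP] := @independent_growth X hs [::] _ _ _ D.
- exact: Hhs.
- by rewrite cats0.
- by rewrite cats0.
rewrite Hsz -/P in HP.
have E : 'C(T1 + D + n', T1 + D) = 'C(D + T1 + n', n').
  by rewrite -(bin_sub (leq_addr n' (T1 + D))) addKn [(T1 + D)%N]addnC.
have := leq_mul (independent_bound HN) (leqnn P); rewrite E => /(leq_trans HP).
have H : (P.+1 * 'C(D + n', n') <= #|X| * 'C(D + n', n'))%N by rewrite leq_mul2r lt orbT.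
move=> /(leq_trans H); rewrite leqNgt [X in (X < _)%N]mulnC.
by rewrite ltn_bin_shift.
Qed.

End Bezout.
End Bezout.

(** * Choice of the left forms and of the equations for the points *)

Module Greedy.
Import mpoly RegularSequences NonVanishing Normalization Extension Avoidance GenericForms Bezout.
Import GRing.Theory.

Lemma sum_leq_witness (I : finType) (i0 : I) (A B : I -> nat) :
  \sum_i A i <= \sum_i B i -> exists i, A i <= B i.
Proof.
move=> le; case: (boolP [exists i, A i <= B i]) => [/existsP //|].
rewrite negb_exists => /forallP H; move: le; rewrite leqNgt => /negP[].
have lt i : B i < A i by rewrite ltnNge.
rewrite (bigD1 i0) //= [X in _ < X](bigD1 i0) //= -addSn.
by apply: leq_add => //; apply: leq_sum => i _; apply: ltnW.
Qed.

Fixpoint subseqs_upto (T : Type) j (s : seq T) : seq (seq T) :=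
  match s with
  | [::] => [:: [::]]
  | x :: s' => subseqs_upto j s' ++
      (if j is j'.+1 then [seq x :: l | l <- subseqs_upto j' s'] else [::])
  end.

Lemma size_subseqs_upto (T : Type) j (s : seq T) :
  size (subseqs_upto j s) <= (size s).+1 ^ j.
Proof.
elim: s j => [|x s IH] [|j] /=; rewrite ?exp1n //.
  by rewrite cats0; have := IH 0%N; rewrite expn0.
rewrite size_cat size_map; apply: leq_trans (leq_add (IH _) (IH _)) _.
rewrite expnS addnC -mulSn [X in _ <= X]expnS leq_mul2l; apply/orP; right.
by case: j => // j; rewrite leq_exp2r.
Qed.

Lemma mem_subseqs_upto (T : eqType) j (s l : seq T) :
  (l \in subseqs_upto j s) = subseq l s && (size l <= j).
Proof.
elim: s j l => [|x s IH] j l /=.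
  by rewrite inE; case: l.
rewrite mem_cat IH; case: l => [|y l]; first by rewrite sub0seq.
rewrite /=; case: j => [|j].
  by rewrite !andbF.
have Hmap : (y :: l \in [seq x :: l0 | l0 <- subseqs_upto j s]) = (y == x) && (l \in subseqs_upto j s).
  apply/mapP/andP => [[l0 H0 [-> ->]]|[/eqP -> H]]; first by rewrite eqxx.
  by exists l.
rewrite Hmap IH; case: eqP => [->|_] /=; last by rewrite orbF.
rewrite ltnS; case: (size l <= j); rewrite ?andbF //= ?andbT.
apply: orb_idl => /(subseq_trans _); apply; exact: subseq_cons.
Qed.

Local Open Scope ring_scope.

Section Incidences.
Variables (n' : nat) (F : finFieldType).
Local Notation n := n'.+1.
Local Notation q := #|F|.
Local Notation R := {mpoly F[n]}.
Local Notation point := {ffun 'I_n' -> F}.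
Implicit Types (hs ys : seq R).

Definition ev (h : R) (x : point) := h.@[affine_point x].

Lemma ev_shift h k a x : ev (h - a *: ('X_ord0 : R) ^+ k) x = ev h x - a.
Proof.
by rewrite /ev mevalB mevalZ rmorphXn /= mevalXU affine_point0 expr1n mulr1.
Qed.

Lemma homog_X0 : ('X_ord0 : R) \is 1.-homog.
Proof. by rewrite dhomogX; apply/eqP/mdeg1. Qed.

(** Setting the variables in [s] to zero kills their ideal, fixes the new variable, and changes a
    polynomial only by an element of that ideal. *)
Lemma regular_vars (s : seq 'I_n) : uniq s -> regular [seq ('X_i : R) | i <- s].
Proof.
elim: s => //= i s IH /andP[Hi Hs]; split; last exact: IH.
move=> d p _ Hip.
pose kill (j : 'I_n) : R := if j \in s then 0 else 'X_j.
have kill_p : mmap (@mpolyC n F) kill p = 0.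
  have : mmap (@mpolyC n F) kill ('X_i * p) = 0.
    apply: (ideal_rmorph (phi := mmap (@mpolyC n F) kill) _ Hip) => h /mapP[j Hj ->] /=.
    by rewrite mmapX mmap1U /kill Hj.
  rewrite rmorphM /= mmapX mmap1U /kill (negbTE Hi) => /eqP.
  by rewrite mulf_eq0 -msupp_eq0 msuppX /= => /eqP.
have Ep : mmap (@mpolyC n F) (fun j => 'X_j) p = p.
  rewrite [RHS]mpolyE /mmap; apply: eq_bigr => m _.
  by rewrite mmap1_id mul_mpolyC.
rewrite -Ep -[X in ideal _ X]subr0 -kill_p; apply: mmap_congr => j.
rewrite /kill; case: ifP => Hj; last by rewrite subrr; apply: ideal0.
by rewrite subr0; apply: ideal_mem; apply: (map_f (fun j : 'I_n => 'X_j : R)).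
Qed.

Lemma good_nil K : good (tau n' K 0) ([::] : seq R).
Proof.
exists [seq ('X_i : R) | i <- enum 'I_n].
  by rewrite size_map size_enum_ord addn0.
have Hl : lines [seq ('X_i : R) | i <- enum 'I_n].
  by move=> y /mapP[i _ ->]; rewrite dhomogX; apply/eqP/mdeg1.
split=> //; rewrite cats0; first by apply: regular_vars; apply: enum_uniq.
move=> T p /= T0 Hp; rewrite (mpolyE p) big_seq; apply: ideal_sum => m Hm.
rewrite -mul_mpolyC; apply: idealMl.
have Em : mdeg m = T := dhomog_mf Hp Hm.
have [i Hi] : exists i, m i != 0%N.
  apply/existsP; move: T0; apply: contraTT; rewrite negb_exists => /forallP Z.
  by rewrite -Em mdegE big1 // => i _; apply/eqP; move: (Z i); rewrite negbK.
rewrite -(submK (m := U_(i)%MM) (m' := m)); last by rewrite lep1mP.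
rewrite mpolyXD; apply: idealMl; apply: ideal_mem.
by apply: (map_f (fun i : 'I_n => 'X_i : R)); rewrite mem_enum.
Qed.

Lemma pigeon_value (h : point -> F) (P : {set point}) :
  exists a : F, (#|P| <= q * #|[set x in P | h x == a]|)%N.
Proof.
have [|a] := @sum_leq_witness F 0 (fun=> #|P|) (fun a => q * #|[set x in P | h x == a]|)%N.
  rewrite sum_nat_const -big_distrr /= leq_mul2l; apply/orP; right.
  rewrite -sum1_card (partition_big h predT) //=; apply: leq_sum => a _.
  by rewrite -sum1_card; rewrite (eq_bigl (fun x => (x \in P) && (h x == a))) // => x; rewrite inE.
by exists a.
Qed.

Lemma regular_catr l hs : regular (l ++ hs) -> regular hs.
Proof. by elim: l => //= a l IH [_ /IH]. Qed.

Lemma good_regular T0 hs : good T0 hs -> regular hs.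
Proof. by move=> [ys _ [_ _ /regular_catr]]. Qed.

Section Choice.
Variables (s r K Bnd : nat).
Hypothesis HB : bounded_by n' q K Bnd.
Hypothesis s_gt0 : (0 < s)%N.
Hypothesis Hn : (s + r = n')%N.

(** A new form only has to extend the at most (m + 1)^(s-1) sequences of fewer than s earlier ones.
    These leave at least r + 2 parameters, whence the dimension 'C(k + r.+1, k). *)
Lemma choose_left k m : (0 < k <= K)%N ->
  (m.+1 ^ s.-1 * (q * Bnd) < q ^ 'C(k + r.+1, k))%N ->
  exists fs : seq R, [/\ size fs = m,
    forall f, f \in fs -> f \is k.-homog /\
      (q ^ n'.-1 <= #|[set x : point | ev f x == 0%R]|)%N
    & forall hs, subseq hs fs -> (size hs <= s)%N -> good (tau n' K (size hs)) hs].
Proof.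
move=> Hk; elim: m => [|m IH] Hm.
  exists [::]; split=> // hs; rewrite subseq0 => /eqP -> _; exact: good_nil.
have [|fs [Sfs Hfs Hgood]] := IH.
  apply: leq_ltn_trans Hm; rewrite leq_mul2r; apply/orP; right.
  by case: (s.-1) => // j; rewrite leq_exp2r.
have [||h Hh Hext] := @avoid n' F (subseqs_upto s.-1 fs) K Bnd k 'C(k + r.+1, k) _ HB Hk homog_X0.
  - move=> hs; rewrite mem_subseqs_upto => /andP[Hs les].
    have les' : (size hs <= s)%N by rewrite (leq_trans les) // leq_pred.
    split; first exact: Hgood.
    exists (n' - size hs)%N; split.
      by rewrite subnKC //; apply: (leq_trans les'); rewrite -Hn leq_addr.
    apply: leq_bin2l; rewrite leq_add2l.
    by move: (size hs) les s_gt0 Hn; clear; lia.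
  - apply: leq_ltn_trans Hm; rewrite leq_mul2r; apply/orP; right.
    apply: leq_trans (size_subseqs_upto _ _) _; rewrite Sfs.
    by case: (s.-1) => // j; rewrite leq_exp2r.
have [a Ha] := pigeon_value (ev h) setT.
pose f : R := h - a *: 'X_ord0 ^+ k.
have Hf : f \is k.-homog.
  by apply: rpredB => //; apply: rpredZ; have := dhomogMn k homog_X0; rewrite mul1n.
exists (f :: fs); split; first by rewrite /= Sfs.
  move=> g; rewrite inE => /orP[/eqP ->|/Hfs //]; split=> //.
  move: Ha; rewrite cardsT card_ffun card_ord.
  rewrite -{1}(prednK (n := n')) ?(leq_trans s_gt0) -?Hn ?leq_addr // expnS leq_pmul2l; last first.
    exact: (ltn_trans _ (finNzRing_gt1 F)).
  move=> /leq_trans; apply; apply/subset_leq_card/subsetP => x.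
  by rewrite !inE /= /f ev_shift subr_eq0.
move=> [|g hs]; first by move=> _ _; apply: good_nil.
rewrite [subseq _ _]/=; case: eqP => [->|_] Hs les; last exact: Hgood.
apply: Hext; rewrite mem_subseqs_upto Hs /=.
by move: les s_gt0 => /=; case: (s).
Qed.

Definition zero_set (gs : seq R) := [set x : point | all (fun g => ev g x == 0%R) gs].
Definition left_degree (fs : seq R) (x : point) := count (fun f => ev f x == 0%R) fs.

(* The constants of the g_i are chosen so as to keep the quantity
   2 q e(P) - m |P| at least 1/q of its previous value. *)
Lemma choose_right fs Ds m :
  size fs = m -> (forall f, f \in fs -> (q ^ n'.-1 <= #|zero_set [:: f]|)%N) ->
  (forall hs, subseq hs fs -> size hs = s -> good (tau n' K s) hs) ->
  (size Ds <= r)%N -> (forall D, D \in Ds -> (0 < D <= K)%N) ->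
  (forall i, (i < size Ds)%N ->
    (m.+1 ^ s * (q * Bnd) < q ^ 'C(nth 0 Ds i + (r - i), nth 0 Ds i))%N) ->
  exists gs : seq (nat * R),
   [/\ size gs = size Ds,
       (\prod_(x <- gs) x.1 = \prod_(D <- Ds) D)%N,
       forall x, x \in gs -> (0 < x.1)%N /\ x.2 \is (x.1).-homog,
       forall hs, subseq hs fs -> size hs = s ->
         good (tau n' K (s + size gs)) (map snd gs ++ hs)
     & let P := zero_set (map snd gs) in
       (m * #|P| + m * q ^ (n' - size gs) <= 2 * q * \sum_(x in P) left_degree fs x)%N].
Proof.
move=> Sfs Hfs Hgood; elim/last_ind: Ds => [|Ds D IH] HDr HDK HD.
  exists [::]; split=> //.
  - by rewrite !big_nil.
  - by move=> hs H1 H2; rewrite addn0; apply: Hgood.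
  have n0 : (0 < n')%N by rewrite -Hn addn_gt0 s_gt0.
  have EP : zero_set [::] = setT by apply/setP => x; rewrite !inE.
  (* With no equation yet there are at least m q^(n'-1) edges, so 2 q e(P) is at least 2 m q^n' = m
     |P| + m q^n'. *)
  rewrite /= EP subn0 cardsT card_ffun card_ord.
  rewrite (_ : \sum_(x in setT) _ = \sum_(f <- fs) #|zero_set [:: f]|)%N; last first.
    under [RHS]eq_bigr => f _ do rewrite -sum1_card big_mkcond /=.
    rewrite exchange_big /=; apply: eq_big => [x|x _]; first by rewrite inE.
    rewrite /left_degree -sum1_count big_mkcond; apply: eq_bigr => f _.
    by rewrite inE /= andbT.
  apply: (@leq_trans (2 * q * \sum_(f <- fs) q ^ n'.-1)%N); last first.
    rewrite leq_mul2l; apply/orP; right; rewrite !big_seq.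
    by apply: leq_sum => f; apply: Hfs.
  rewrite big_const_seq count_predT iter_addn_0 Sfs addnn -mul2n -mulnA leq_mul2l /=.
  by rewrite mulnA -expnS prednK // mulnC.
have [|x Hx|i Hi|gs [Sgs Pgs Hgs Ggs Wgs]] := IH.
- by apply: leq_trans HDr; rewrite size_rcons.
- by apply: HDK; rewrite mem_rcons inE Hx orbT.
- have := HD i; rewrite size_rcons nth_rcons Hi; apply; exact: ltnW.
have {}HDr : (size gs < r)%N by rewrite Sgs -(size_rcons Ds D).
have {}HD : (m.+1 ^ s * (q * Bnd) < q ^ 'C(D + (r - size gs), D))%N.
  by have := HD (size Ds); rewrite size_rcons nth_rcons ltnn eqxx Sgs; apply.
have HDK' : (0 < D <= K)%N by apply: HDK; rewrite mem_rcons inE eqxx.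
(* Only sequences of exactly s left forms count from here on: it is their common zeros that have to
   be bounded. *)
pose U := [seq map snd gs ++ hs | hs <- subseqs_upto s fs & size hs == s].
have HU hs : subseq hs fs -> size hs = s -> map snd gs ++ hs \in U.
  move=> H1 H2; apply: (map_f (fun hs => map snd gs ++ hs)).
  by rewrite mem_filter H2 eqxx mem_subseqs_upto H1 H2 leqnn.
have [||h Hh Hext] := @avoid n' F U K Bnd D 'C(D + (r - size gs), D) _ HB HDK' homog_X0.
- move=> l /mapP[hs]; rewrite mem_filter mem_subseqs_upto => /andP[/eqP S1 /andP[S2 _]] ->.
  have Sl : size (map snd gs ++ hs) = (s + size gs)%N.
    by rewrite size_cat size_map S1 addnC.
  rewrite Sl; split; first exact: Ggs.
  exists (r - size gs)%N; split=> //.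
  by rewrite -addnA subnKC // ltnW.
- apply: leq_ltn_trans HD; rewrite leq_mul2r; apply/orP; right.
  rewrite size_map size_filter; apply: leq_trans (count_size _ _) _.
  by apply: leq_trans (size_subseqs_upto _ _) _; rewrite Sfs.
pose t := (n' - size gs)%N; set P := zero_set _ in Wgs.
have t0 : (0 < t)%N by rewrite subn_gt0; apply: leq_trans HDr _; rewrite -Hn leq_addl.
pose Pa (a : F) := [set x in P | ev h x == a].
have sumP (G : point -> nat) : (\sum_(x in P) G x = \sum_a \sum_(x in Pa a) G x)%N.
  rewrite (partition_big (ev h) predT) //=; apply: eq_bigr => a _.
  by apply: eq_bigl => x; rewrite [RHS]inE.
have [|a Ha] := @sum_leq_witness F 0 (fun a => m * #|Pa a| + m * q ^ t.-1)%N
    (fun a => 2 * q * \sum_(x in Pa a) left_degree fs x)%N.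
  rewrite -big_distrr /= -sumP big_split /= -big_distrr /= sum_nat_const.
  rewrite mulnCA -expnS prednK //; apply: leq_trans Wgs; rewrite leq_add2r leq_mul2l.
  apply/orP; right; rewrite -sum1_card sumP; apply: leq_sum => a _.
  by rewrite sum1_card.
pose g := h - a *: 'X_ord0 ^+ D.
have Hg : g \is D.-homog.
  by apply: rpredB => //; apply: rpredZ; have := dhomogMn D homog_X0; rewrite mul1n.
exists ((D, g) :: gs); split.
- by rewrite /= size_rcons Sgs.
- by rewrite big_cons big_rcons Pgs mulnC.
- by move=> x; rewrite inE => /orP[/eqP ->|/Hgs //]; split=> //; case/andP: HDK'.
- move=> hs H1 H2; have := Hext _ a (HU hs H1 H2).
  by rewrite size_cat size_map H2 /= addnS [(size gs + s)%N]addnC.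
have EP : zero_set (map snd ((D, g) :: gs)) = Pa a.
  apply/setP => x; rewrite !inE /= /g ev_shift subr_eq0 andbC.
  by congr (_ && _); rewrite /P inE.
by move=> /=; rewrite [zero_set _]EP subnS.
Qed.

(** The number of points cut out by the equations is not controlled; the two terms on the left of
    the density bound allow for too few and for too many of them. *)
Lemma algebraic_incidence k m Ds : (0 < k <= K)%N -> size Ds = r ->
  (forall D, D \in Ds -> (0 < D <= K)%N) ->
  (m.+1 ^ s * (q * Bnd) < q ^ 'C(k + r.+1, k))%N ->
  (forall i, (i < r)%N ->
    (m.+1 ^ s * (q * Bnd) < q ^ 'C(nth 0 Ds i + (r - i), nth 0 Ds i))%N) ->
  exists (P : {set point}) (E : 'I_m -> point -> bool),
    (m * #|P| + m * q ^ s <= 2 * q * \sum_(x in P) #|[set u | E u x]|)%N /\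
    forall A : {set 'I_m}, #|A| = s ->
      (#|[set x in P | [forall u in A, E u x]]| <= k ^ s * \prod_(D <- Ds) D)%N.
Proof.
move=> Hk SDs HDK Hk' HD.
have [|fs [Sfs Hfs Hgood]] := @choose_left k m Hk.
  apply: leq_ltn_trans Hk'; rewrite leq_mul2r; apply/orP; right.
  by rewrite leq_pexp2l // leq_pred.
have [|||||gs [Sgs Pgs Hgs Ggs Wgs]] := @choose_right fs Ds m Sfs.
- move=> f /Hfs[_ le]; apply: leq_trans le _; apply/subset_leq_card/subsetP => x.
  by rewrite !inE /= andbT.
- by move=> hs H1 H2; rewrite -H2; apply: Hgood => //; rewrite H2.
- by rewrite SDs.
- exact: HDK.
- by rewrite SDs.
exists (zero_set (map snd gs)); exists (fun u x => ev fs`_u x == 0); split.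
  rewrite (_ : s = n' - size gs)%N; last by rewrite Sgs SDs -Hn addnK.
  apply: leq_trans Wgs _; rewrite leq_mul2l; apply/orP; right.
  apply: leq_sum => x _; rewrite /left_degree cardsE -sum1_card -sum1_count.
  rewrite (big_nth 0) Sfs big_mkord; apply: eq_leq; apply: eq_bigl => u.
  by rewrite unfold_in.
move=> A SA; pose hs := map (fun u : 'I_m => fs`_u) (enum A).
have Hhs : subseq hs fs.
  have E : fs = map (fun u : 'I_m => fs`_u) (enum 'I_m).
    rewrite -[LHS](mkseq_nth 0) Sfs /mkseq -val_enum_ord -map_comp.
    exact: eq_map.
  by rewrite [X in subseq _ X]E; apply: map_subseq; rewrite enumT; apply: filter_subseq.
have Shs : size hs = s by rewrite size_map -cardE SA.
have HGs := good_regular (Ggs hs Hhs Shs).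
pose all := gs ++ [seq (k, f) | f <- hs].
have Eall : map snd all = map snd gs ++ hs.
  by rewrite map_cat -map_comp map_id.
have Hprod : (\prod_(x <- all) x.1 = k ^ s * \prod_(D <- Ds) D)%N.
  by rewrite big_cat /= Pgs big_map big_const_seq count_predT iter_muln_1 Shs mulnC.
rewrite -Hprod; apply: (@bezout n' F).
- move=> x; rewrite mem_cat => /orP[/Hgs //|/mapP[f Hf ->]] /=.
  by case/andP: Hk => ? _; split=> //; have [] := Hfs f (mem_subseq Hhs Hf).
- move=> h x; rewrite Eall mem_cat inE => Hh /andP[]; rewrite inE => /allP Hx /forall_inP HA.
  case/orP: Hh => [/Hx /eqP //|/mapP[u Hu ->]]; apply/eqP/HA.
  by rewrite -mem_enum.
- by rewrite Eall.
- by rewrite size_cat size_map Shs Sgs SDs addnC.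
Qed.

End Choice.
End Incidences.
End Greedy.

(** * Field size requirements, and from incidences to Zarankiewicz numbers *)

Module Incidence.
Import mpoly Avoidance GenericForms Greedy.

Lemma nmon_le n' T0 : nmon n' T0 <= T0 ^ n'.+1.
Proof.
case: T0 => [|T]; first by rewrite /nmon eq_card0 // => m; have := bmdeg m; rewrite ltn0.
pose f (m : 'X_{1..n'.+1 < T.+1}) : {ffun 'I_n'.+1 -> 'I_T.+1} := [ffun i => inord (m i)].
have lt (m : 'X_{1..n'.+1 < T.+1}) i : m i < T.+1.
  by apply: leq_ltn_trans (bmdeg m); rewrite mdegE (bigD1 i) //= leq_addr.
rewrite -[X in X ^ _]card_ord -[X in _ ^ X]card_ord -card_ffun.
apply: (@leq_card _ _ f) => m m' E; apply/val_inj/mnmP => i.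
have := congr1 (fun g : {ffun 'I_n'.+1 -> 'I_T.+1} => val (g i)) E.
by rewrite !ffunE /= !inordK.
Qed.

Lemma rel_deg_le n' K a T0 : n' < K -> 1 < K -> T0 <= K ^ a ->
  rel_deg n' T0 K < K ^ (2 * (a * n'.+1) + 5).
Proof.
move=> lenK K1 leT; rewrite /rel_deg; set N := nmon _ _; set b := a * n'.+1.
have leN : N <= K ^ b.
  apply: leq_trans (nmon_le _ _) _; rewrite /b expnM.
  by rewrite leq_exp2r.
have K0 : 0 < K ^ b by rewrite expn_gt0 ltnW.
have E : K ^ (2 * b + 5) = K ^ b * K ^ b * (K ^ 5).
  by rewrite expnD mul2n -addnn expnD.
set x := K ^ b in leN K0 E *; rewrite E.
have H1 : N.+1 * (n'.+1 * (N * K)) <= (2 * x) * (K * (x * K)).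
  apply: leq_mul; first by lia.
  by apply: leq_mul => //; rewrite leq_mul2r leN orbT.
have H2 : N * K <= x * K by rewrite leq_mul2r leN orbT.
have H3 : (2 * x) * (K * (x * K)) = (x * x) * (2 * K ^ 2) by rewrite -mulnn; lia.
have H4 : x * K <= (x * x) * K ^ 2 by rewrite -mulnn leq_mul // leq_pmull // ltnW.
(* Constant factors are absorbed by K^3 >= 8. *)
have H5 : 8 * K ^ 2 <= K ^ 5.
  by rewrite (expnD K 3 2) leq_mul2r (@leq_exp2r 2 K 3) // K1 orbT.
have H6 : 0 < (x * x) * K ^ 2 by rewrite muln_gt0 expn_gt0 muln_gt0 K0 ltnW.
have H7 : (x * x) * (8 * K ^ 2) <= (x * x) * K ^ 5 by rewrite leq_mul2l H5 orbT.
set y := (x * x) * K ^ 2 in H4 H6.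
have H8 : (x * x) * (8 * K ^ 2) = 8 * y by rewrite /y; lia.
have H9 : (x * x) * (2 * K ^ 2) = 2 * y by rewrite /y; lia.
lia.
Qed.

(** The exponent is fixed before K and q, which matters because K grows with t in the logarithmic
    bound. *)
Lemma bounded_by_exp n' : exists e, forall K q, n' < K -> 1 < K -> K ^ e <= q ->
  bounded_by n' q K q.
Proof.
have [a Ha] : exists a, forall K, n' < K -> 1 < K ->
    forall j, j <= n' -> tau n' K j <= K ^ a.
  have H j : exists a, forall K, n' < K -> 1 < K ->
      forall i, i <= j -> tau n' K i <= K ^ a.
    elim: j => [|j [a IH]].
      by exists 0 => K _ _ i; rewrite leqn0 => /eqP ->; rewrite expn0.
    exists (2 * (a * n'.+1) + 6 + a) => K Kn K1 i; rewrite leq_eqVlt => /orP[/eqP ->|].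
      have IHj := IH K Kn K1 j (leqnn j).
      have := rel_deg_le Kn K1 IHj; rewrite /= => H.
      have K0 : 0 < K by apply: ltnW.
      rewrite (_ : _ + 6 + a = 2 * (a * n'.+1) + 5 + a.+1); last by lia.
      rewrite expnD expnS; set y := K ^ (_ + 5) in H *.
      have y0 : 0 < y by rewrite expn_gt0 K0.
      have z0 : 0 < K ^ a by rewrite expn_gt0 K0.
      have L1 : 2 * (y * K ^ a) <= K * (y * K ^ a) by rewrite leq_mul2r K1 orbT.
      have L2 : K ^ a <= y * K ^ a by apply: leq_pmull.
      have L3 : y <= y * K ^ a by apply: leq_pmulr.
      rewrite mulnCA; lia.
    rewrite ltnS => /(IH K Kn K1 i)/leq_trans; apply.
    by rewrite leq_pexp2l ?leq_addl // ltnW.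
  exact: H.
exists (2 * (a * n'.+1) + 5) => K q Kn K1 leq_q j lej.
have Hj := Ha K Kn K1 j lej; split; last first.
  by apply: leq_trans leq_q; apply: rel_deg_le.
apply: leq_trans leq_q; apply: leq_trans (nmon_le _ _) _.
apply: (@leq_trans ((K ^ a) ^ n'.+1)); first by rewrite leq_exp2r.
by rewrite -expnM leq_pexp2l ?(ltnW K1) //; lia.
Qed.

Section Combinatorics.
Variables (m n s t : nat) (T : finType) (E : 'I_m -> T -> bool).
Implicit Types P : {set T}.

Local Notation deg x := #|[set u | E u x]|.

(** A point of degree at most m / c can be deleted without loss; if there is none, all degrees
    exceed m / c and any point may go. *)
Lemma shrink_average c P : n <= #|P| -> m * #|P| <= c * \sum_(x in P) deg x ->
  exists2 P' : {set T}, P' \subset P & (#|P'| = n) /\ m * n <= c * \sum_(x in P') deg x.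
Proof.
move: {2}(#|P| - n) (erefl (#|P| - n)) => d; elim: d P => [|d IH] P Ed le Hc.
  have EP : #|P| = n by apply/eqP; rewrite eqn_leq le andbT -subn_eq0 Ed.
  by exists P; rewrite ?subxx // EP; split=> //; move: Hc; rewrite EP.
have lt : n < #|P| by rewrite -subn_gt0 Ed.
have [x Px Hx] : exists2 x, x \in P & m * #|P :\ x| <= c * \sum_(y in P :\ x) deg y.
  case: (boolP [exists x in P, c * deg x <= m]) => [/exists_inP[x Px Hx]|].
    exists x => //; move: Hc; rewrite (big_setD1 x) //= (cardsD1 x P) Px mulnDr mulnDr.
    rewrite muln1 => H; rewrite -(leq_add2l m); apply: leq_trans H _.
    by rewrite leq_add2r.
  rewrite negb_exists_in => /forall_inP H.
  have [x Px] : exists x, x \in P by apply/card_gt0P; apply: leq_ltn_trans lt.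
  exists x => //; rewrite big_distrr /= mulnC -sum_nat_const; apply: leq_sum => y.
  by rewrite inE => /andP[_ /H]; rewrite -ltnNge => /ltnW.
have ED : #|P :\ x| = #|P|.-1 by rewrite (cardsD1 x P) Px.
have [||//|P' sP' HP'] := IH (P :\ x); [by rewrite ED; lia|by rewrite ED; lia|].
by exists P' => //; apply: subset_trans sP' (subD1set _ _).
Qed.

(** If |P| <= n, the term m Q already gives the edges; if |P| > n, the term m |P| bounds the average
    degree, and P is cut down to n points. *)
Lemma zarankiewicz_ge P c Q : 0 < s -> Q <= n ->
  m * #|P| + m * Q <= c * \sum_(x in P) deg x ->
  (forall A : {set 'I_m}, #|A| = s -> #|[set x in P | [forall u in A, E u x]]| < t) ->
  m * Q <= c * zarankiewicz m n s t.
Proof.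
move=> s0 leQ Hc HA.
have [P' sP' [leP' Hc']] : exists2 P' : {set T}, P' \subset P & #|P'| <= n /\
    m * Q <= c * \sum_(x in P') deg x.
  case: (leqP #|P| n) => [le|lt].
    by exists P => //; split=> //; apply: leq_trans Hc; apply: leq_addl.
  have [|P' sP' [EP' H]] := @shrink_average c P (ltnW lt).
    by apply: leq_trans Hc; apply: leq_addr.
  exists P'; rewrite // EP'; split=> //; apply: leq_trans H.
  by rewrite leq_mul2l leQ orbT.
case: (set_0Vmem P') => [P0|[x0 Px0]].
  by apply: leq_trans Hc' _; rewrite P0 big_set0 muln0.
apply: (leq_trans Hc'); rewrite leq_mul2l; apply/orP; right.
pose G : {set 'I_m * 'I_n} :=
  [set p : 'I_m * 'I_n | (p.2 < #|P'|) && E p.1 (nth x0 (enum P') p.2)].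
have cardG : \sum_(x in P') deg x = #|G|.
  rewrite -big_enum /= (big_nth x0) -cardE big_mkord.
  rewrite (big_ord_widen n (fun i => deg (nth x0 (enum P') i))) //.
  transitivity (\sum_(j : 'I_n) \sum_(u : 'I_m) ((u, j) \in G)).
    rewrite big_mkcond; apply: eq_bigr => j _; case: ifP => Hj; last first.
      by rewrite big1 // => u _; rewrite inE /= Hj.
    rewrite cardsE -sum1_card big_mkcond; apply: eq_bigr => u _.
    by rewrite inE /= Hj unfold_in; case: (E _ _).
  rewrite exchange_big pair_bigA -sum1_card [RHS]big_mkcond.
  by apply: eq_bigr => [[u j]] _ /=; case: (_ \in _).
rewrite cardG; apply: (@leq_bigmax_cond _ _ (fun G : {set 'I_m * 'I_n} => #|G|)).
apply/negP => /existsP[A /existsP[B /and3P[/eqP SA /eqP SB sAB]]].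
have [u0 Hu0] : exists u, u \in A by apply/card_gt0P; rewrite SA.
have HAB u j : u \in A -> j \in B -> (j < #|P'|) && E u (nth x0 (enum P') j).
  move=> Hu Hj; have : (u, j) \in G by apply: (subsetP sAB); rewrite inE /= Hu Hj.
  by rewrite inE.
have := HA A SA; rewrite ltnNge -SB => /negP[].
rewrite -(card_in_imset (f := fun j : 'I_n => nth x0 (enum P') j)).
  apply/subset_leq_card/subsetP => x /imsetP[j Hj ->]; rewrite inE.
  have /andP[lt _] := HAB _ _ Hu0 Hj.
  have HP' : nth x0 (enum P') j \in P' by rewrite -mem_enum mem_nth // -cardE.
  rewrite (subsetP sP') //=; apply/forall_inP => u Hu.
  by have /andP[] := HAB _ _ Hu Hj.
move=> i j Hi Hj /eqP; have /andP[lti _] := HAB _ _ Hu0 Hi.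
have /andP[ltj _] := HAB _ _ Hu0 Hj.
by rewrite nth_uniq ?enum_uniq -?cardE // => /eqP/val_inj.
Qed.
End Combinatorics.

(** Fields of order 2^a suffice: powers of 2 approximate every size within a factor 2, which costs
    only a constant depending on s. *)
Theorem zarankiewicz_algebraic s r : 0 < s -> exists e, forall K k m n t a Ds,
  let q := 2 ^ a in
  0 < a -> s + r < K -> 1 < K -> K ^ e <= q -> 0 < k <= K ->
  size Ds = r -> (forall D, D \in Ds -> 0 < D <= K) ->
  m.+1 ^ s * q ^ 2 < q ^ 'C(k + r.+1, k) ->
  (forall i, i < r -> m.+1 ^ s * q ^ 2 < q ^ 'C(nth 0 Ds i + (r - i), nth 0 Ds i)) ->
  q ^ s <= n -> k ^ s * \prod_(D <- Ds) D < t ->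
  m * q ^ s.-1 <= 2 * zarankiewicz m n s t.
Proof.
move=> s0; have [e He] := bounded_by_exp (s + r).
exists e => K k m n t a Ds q a0 Kn K1 leq_q Hk SDs HDs HC HCi leq_n lt_t.
have [F _ cardF] := PrimePowerField (isT : prime 2) a0.
rewrite -[2 ^ a]/q in cardF.
have HB : bounded_by (s + r) #|F| K q by rewrite cardF; apply: He.
have [||P [E [HP HA]]] := @algebraic_incidence (s + r) F s r K q HB s0 (erefl _) k m Ds Hk SDs HDs.
- by rewrite cardF mulnn.
- by move=> i Hi; rewrite cardF mulnn; apply: HCi.
rewrite cardF in HP.
have q0 : 0 < q by rewrite expn_gt0.
have : m * q ^ s <= 2 * q * zarankiewicz m n s t.
  apply: (zarankiewicz_ge s0 leq_n HP) => A SA.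
  exact: leq_ltn_trans (HA A SA) lt_t.
have -> : q ^ s = q * q ^ s.-1 by rewrite -expnS prednK.
by rewrite (mulnCA m) -(mulnA 2) (mulnCA 2) leq_pmul2l.
Qed.

End Incidence.

(** * Random colourings, for n small against t *)

Module RandomColouring.
Import GenericForms Greedy.

Lemma card_prescribed (T V : finType) (S : {set T}) (c : T -> V) :
  #|[set phi : {ffun T -> V} | [forall x in S, phi x == c x]]| * #|V| ^ #|S| <= #|V| ^ #|T|.
Proof.
pose F (x : T) : pred V := if x \in S then pred1 (c x) else predT.
have -> : #|[set phi : {ffun T -> V} | [forall x in S, phi x == c x]]| = #|family F|.
  apply: eq_card => phi; rewrite inE; apply/forall_inP/familyP => H x.
    by rewrite /F; case: ifP => // Hx; have := H x Hx.
  by move=> Hx; have := H x; rewrite /F Hx.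
rewrite card_family foldrE big_map big_enum /=.
rewrite (bigID (mem S)) /= big1 ?mul1n => [|x Hx]; last by rewrite /F Hx card1.
rewrite (eq_bigr (fun=> #|V|)) => [|x Hx]; last by rewrite /F (negbTE Hx).
rewrite prod_nat_const -expnD; have := cardC (mem S).
rewrite addnC => <-; apply: eq_leq; congr (_ ^ (_ + _)).
Qed.

(** Colour all pairs with b colours and let each left vertex keep its most popular colour: at least
    mn/b edges remain for every colouring. Given s left vertices, their colours and t right
    vertices, a K_{s,t} prescribes st colours. The union bound m^s b^s 'C(n, t) b^(-st) is at most
    m^s b^s / t! because n <= b^s. *)
Theorem zarankiewicz_random m n s t b : 0 < s -> 0 < b -> n <= b ^ s ->
  m ^ s * b ^ s < t`! -> m * n <= b * zarankiewicz m n s t.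
Proof.
move=> s0 b0 leq_n lt_t; case: b b0 leq_n lt_t => // b' _; set b := b'.+1 => leq_n lt_t.
pose I := ({ffun 'I_s -> 'I_m} * {ffun 'I_s -> 'I_b} * {set 'I_n})%type.
pose bad (i : I) : {set {ffun 'I_m * 'I_n -> 'I_b}} :=
  [set phi : {ffun 'I_m * 'I_n -> 'I_b} | [forall j, forall x in i.2, phi (i.1.1 j, x) == i.1.2 j]].
pose idx : {set I} := [set i : I | injectiveb i.1.1 & #|i.2| == t].
have card_bad i : i \in idx -> #|bad i| * b ^ (s * t) <= b ^ (m * n).
  case: i => [[u a] X]; rewrite inE /= => /andP[/injectiveP u_inj /eqP SX].
  pose S := [set (u j, x) | j in setT, x in X].
  have SS : #|S| = s * t.
    rewrite /S curry_imset2X card_in_imset ?cardsX ?cardsT ?card_ord ?SX //.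
    by move=> [j x] [j' x'] _ _ /= [/u_inj -> ->].
  pose c (p : 'I_m * 'I_n) : 'I_b := if [pick j | u j == p.1] is Some j then a j else ord0.
  have cE j x : c (u j, x) = a j.
    rewrite /c; case: pickP => [j' /eqP/u_inj -> //|/(_ j)]; by rewrite /= eqxx.
  have := card_prescribed S c; rewrite SS card_prod !card_ord; apply: leq_trans.
  rewrite leq_mul2r; apply/orP; right; apply/subset_leq_card/subsetP => phi.
  rewrite !inE => /forallP H; apply/forall_inP => p /imset2P[j x _ Hx ->].
  by rewrite cE; have /forall_inP := H j; apply.
have card_idx : #|idx| <= m ^ s * b ^ s * 'C(n, t).
  have -> : m ^ s * b ^ s * 'C(n, t) =
      #|finset.setX (finset.setX [set: {ffun 'I_s -> 'I_m}] [set: {ffun 'I_s -> 'I_b}])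
         [set X : {set 'I_n} | #|X| == t]|.
    rewrite !cardsX !cardsT !card_ffun !card_ord.
    by have := card_draws 'I_n t; rewrite card_ord => ->.
  apply/subset_leq_card/subsetP => -[[u a] X]; rewrite !inE /= => /andP[_ ->] //.
have lt_bad : #|\bigcup_(i <- enum idx) bad i| < #|{ffun 'I_m * 'I_n -> 'I_b}|.
  rewrite card_ffun card_prod !card_ord.
  have p0 j : 0 < b ^ j by rewrite expn_gt0.
  apply: leq_ltn_trans (card_big_setU _ _) _; rewrite -(ltn_pmul2r (p0 (s * t))).
  apply: (@leq_ltn_trans (#|idx| * b ^ (m * n))).
    rewrite big_distrl /= big_enum /= -sum_nat_const; apply: leq_sum => i; exact: card_bad.
  rewrite mulnC ltn_pmul2l //; apply: leq_ltn_trans card_idx _.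
  rewrite -(ltn_pmul2r (fact_gt0 t)) -mulnA bin_ffact.
  have le_ff : n ^_ t <= b ^ (s * t).
    rewrite expnM; apply: (@leq_trans (n ^ t)); last first.
      by case: (t) => // t'; rewrite leq_exp2r.
    by elim: (t) => // t' IH; rewrite ffactnSr expnSr leq_mul // leq_subr.
  apply: (@leq_ltn_trans (m ^ s * b ^ s * b ^ (s * t))); first by rewrite leq_mul2l le_ff orbT.
  by rewrite mulnC ltn_pmul2l.
have [phi Hphi] : exists phi, phi \notin \bigcup_(i <- enum idx) bad i.
  apply/existsP; move: lt_bad; apply: contraTT; rewrite negb_exists => /forallP H.
  rewrite -leqNgt -cardsT; apply/subset_leq_card/subsetP => phi _.
  by move: (H phi); rewrite negbK.
have /fin_all_exists [a Ha] : forall u : 'I_m, exists c : 'I_b,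
    n <= b * #|[set x | phi (u, x) == c]|.
  move=> u.
  have [|c Hc] := @sum_leq_witness 'I_b ord0 (fun=> n) (fun c => b * #|[set x | phi (u, x) == c]|).
    rewrite sum_nat_const card_ord -big_distrr /= leq_mul2l -[X in X <= _]card_ord -sum1_card.
    rewrite (partition_big (fun x => phi (u, x)) predT) //=.
    by apply: leq_sum => c _; rewrite -sum1_card; apply: eq_leq; apply: eq_bigl => x; rewrite inE.
  by exists c.
pose G : {set 'I_m * 'I_n} := [set p | phi p == a p.1].
apply: (@leq_trans (b * #|G|)).
  have -> : #|G| = \sum_u #|[set x | phi (u, x) == a u]|.
    transitivity (\sum_(u : 'I_m) \sum_(x : 'I_n) ((u, x) \in G)).
      rewrite pair_bigA -sum1_card [LHS]big_mkcond.
      by apply: eq_bigr => [[u x]] _ /=; case: (_ \in _).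
    apply: eq_bigr => u _; rewrite -sum1_card [RHS]big_mkcond; apply: eq_bigr => x _.
    by rewrite !inE /=; case: (_ == _).
  rewrite big_distrr /= -[X in X * n](card_ord m) -sum_nat_const.
  by apply: leq_sum => u _; apply: Ha.
rewrite leq_mul2l; apply/orP; right.
apply: (@leq_bigmax_cond _ _ (fun G : {set 'I_m * 'I_n} => #|G|)).
apply/negP => /existsP[A /existsP[B /and3P[/eqP SA /eqP SB sAB]]].
move/negP: Hphi; apply.
pose u := [ffun j : 'I_s => enum_val (cast_ord (esym SA) j)].
pose i : I := (u, [ffun j => a (u j)], B).
have Hi : i \in idx.
  rewrite inE /= SB eqxx andbT; apply/injectiveP => j j'; rewrite !ffunE.
  by move/enum_val_inj/cast_ord_inj.
rewrite (big_rem i) ?mem_enum //= inE; apply/orP; left.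
rewrite inE; apply/forallP => j; apply/forall_inP => x /= Hx.
have : (u j, x) \in G by apply: (subsetP sAB); rewrite inE /= Hx andbT ffunE enum_valP.
by rewrite inE => /eqP H; apply/eqP; rewrite [RHS]ffunE; apply: H.
Qed.
End RandomColouring.

(** * Lower bounds in integer form, for arbitrary n *)

Module LowerBounds.
Import Incidence RandomColouring.

Lemma zarankiewicz_ge_card m n s t (G : {set 'I_m * 'I_n}) :
  ~~ contains_sided_K G s t -> #|G| <= zarankiewicz m n s t.
Proof. by move=> H; apply: (@leq_bigmax_cond _ _ (fun G : {set 'I_m * 'I_n} => #|G|)). Qed.

Lemma zarankiewicz_ge_left m n s t : 0 < s -> 1 < t -> 0 < n -> m <= zarankiewicz m n s t.
Proof.
move=> s0 t1; case: n => // n _.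
pose G := [set (u, ord0) | u in 'I_m] : {set 'I_m * 'I_n.+1}.
have EG : #|G| = m by rewrite card_imset ?card_ord // => u v [].
rewrite -[X in X <= _]EG; apply: zarankiewicz_ge_card; apply/negP => /existsP[A /existsP[B /and3P[/eqP SA /eqP SB sAB]]].
have [u Hu] : exists u, u \in A by apply/card_gt0P; rewrite SA.
have : #|B| <= #|[set ord0 : 'I_n.+1]|.
  apply/subset_leq_card/subsetP => j Hj; rewrite inE.
  have : (u, j) \in G by apply: (subsetP sAB); rewrite inE /= Hu Hj.
  by case/imsetP => v _ [_ ->].
by rewrite cards1 SB leqNgt t1.
Qed.

Lemma zarankiewicz_ge_right m n s t : 1 < s -> 0 < t -> 0 < m -> n <= zarankiewicz m n s t.
Proof.
move=> s1 t0; case: m => // m _.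
pose G := [set (ord0, x) | x in 'I_n] : {set 'I_m.+1 * 'I_n}.
have EG : #|G| = n by rewrite card_imset ?card_ord // => u v [].
rewrite -[X in X <= _]EG; apply: zarankiewicz_ge_card; apply/negP => /existsP[A /existsP[B /and3P[/eqP SA /eqP SB sAB]]].
have [x Hx] : exists x, x \in B by apply/card_gt0P; rewrite SB.
have : #|A| <= #|[set ord0 : 'I_m.+1]|.
  apply/subset_leq_card/subsetP => u Hu; rewrite inE.
  have : (u, x) \in G by apply: (subsetP sAB); rewrite inE /= Hx Hu.
  by case/imsetP => v _ [-> _].
by rewrite cards1 SA leqNgt s1.
Qed.

Lemma expn_le_bin e N : e <= N -> N ^ e <= e ^ e * 'C(N, e).
Proof.
elim: e N => [|e IH] [|N] //; rewrite ltnS => le.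
have := mul_bin_diag N.+1 e; rewrite /= => Ebin.
rewrite [in X in _ <= X]expnSr -mulnA -Ebin mulnCA expnS leq_mul2l.
apply/orP; right; case: e {Ebin} IH le => [|e] IH le; first by rewrite !expn0 mul1n bin0.
have H1 : (N.+1 * e.+1) ^ e.+1 <= (N * e.+2) ^ e.+1 by rewrite leq_exp2r //; lia.
have H2 := IH N le.
rewrite -(leq_pmul2r (_ : 0 < e.+1 ^ e.+1)) ?expn_gt0 //.
rewrite -expnMn; apply: (leq_trans H1); rewrite expnMn mulnC -mulnA leq_mul2l.
by rewrite [X in _ <= X]mulnC H2 orbT.
Qed.

Lemma min_degree_exists e M : exists D, M <= 'C(D + e.+1, e.+1).
Proof.
exists M; elim: M => // M IH; rewrite addSn binS.
by rewrite -addn1 leq_add // bin_gt0; lia.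
Qed.

(* The least degree whose forms in [e + 1] variables, [e > 0], have dimension
   at least [M]; the value at [e = 0] is irrelevant. *)
Definition min_degree e M := ex_minn (min_degree_exists e.-1 M).

(** For the upper bound on D: degree D - 1 offers fewer than M forms by minimality, and D <= D - 1 +
    e. *)
Lemma min_degreeP e M : 0 < e -> 1 < M ->
  [/\ 0 < min_degree e M <= M, M <= 'C(min_degree e M + e, e)
    & min_degree e M ^ e <= e ^ e * M].
Proof.
case: e => // e _ M1; rewrite /min_degree /=; case: ex_minnP => D HD Dmin.
have D0 : 0 < D by case: D HD {Dmin} => //; rewrite add0n binn leqNgt M1.
split=> //; first rewrite D0 /=.
  apply: Dmin; elim: M {M1 HD} => // M IH; rewrite addSn binS.
  by rewrite -addn1 leq_add // bin_gt0; lia.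
apply: (@leq_trans ((D.-1 + e.+1) ^ e.+1)); first by rewrite leq_exp2r //; lia.
apply: leq_trans (expn_le_bin _) _; first exact: leq_addl.
rewrite leq_mul2l; apply/orP; right; rewrite leqNgt; apply/negP => /ltnW/Dmin.
by move: D0; clear; lia.
Qed.

(** q is the largest power of 2 with q^s <= n, so n < (2q)^s; the conclusion is raised to the power
    s to avoid roots. Two units of M pay for the factor q^2, one q for the constants and one for the
    number of bad forms. *)
Theorem zarankiewicz_algebraic_power s r : 0 < s -> exists E, forall k m n t M,
  let K := k + M + s + r + 2 in
  2 < M -> 0 < k -> M <= 'C(k + r.+1, k) ->
  m.+1 ^ (s * s) * (2 ^ s) ^ (M - 2) <= n ^ (M - 2) -> (2 * K ^ E) ^ s <= n ->
  k ^ s * \prod_(e < r) min_degree e.+1 M < t ->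
  m ^ s * n ^ s.-1 <= (2 ^ s * zarankiewicz m n s t) ^ s.
Proof.
move=> s0; have [E HE] := @zarankiewicz_algebraic s r s0.
exists E => k m n t M K M2 k0 HM Hm Hn Ht.
have K0 : 0 < K ^ E by rewrite expn_gt0 /K addn2.
have n_ge : 2 ^ s <= n.
  by apply: leq_trans Hn; rewrite leq_exp2r // leq_pmulr.
have n0 : 0 < n by apply: leq_trans n_ge; rewrite expn_gt0.
have ex0 : exists a, (2 ^ a) ^ s <= n by exists 0; rewrite exp1n.
have bd a : (2 ^ a) ^ s <= n -> a <= n.
  move=> H; apply: leq_trans H; apply: (@leq_trans (2 ^ a)); first exact: ltnW (ltn_expl _ _).
  by rewrite -[X in X <= _]expn1 leq_pexp2l // expn_gt0.
have [a Ha amax] := ex_maxnP ex0 bd; set q := 2 ^ a in Ha.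
have n_lt : n < (2 * q) ^ s.
  by rewrite ltnNge -expnS; apply/negP => /amax; rewrite ltnn.
have a0 : 0 < a by apply: amax; rewrite expn1.
have q0 : 0 < q by rewrite expn_gt0.
have Kq : K ^ E <= q.
  have := leq_ltn_trans Hn n_lt; rewrite ltn_exp2r // ltn_pmul2l //; exact: ltnW.
have Hmq : m.+1 ^ s * q ^ 2 < q ^ M.
  rewrite -(subnK (ltnW M2)) expnD ltn_pmul2r ?expn_gt0 ?q0 //.
  set M' := M - 2 in Hm *; have M'0 : 0 < M' by rewrite subn_gt0.
  rewrite -(ltn_exp2r _ _ s0) -expnM -(ltn_pmul2r (_ : 0 < (2 ^ s) ^ M')); last first.
    by rewrite !expn_gt0.
  apply: (leq_ltn_trans Hm).
  have -> : (q ^ M') ^ s * (2 ^ s) ^ M' = ((2 * q) ^ s) ^ M'.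
    by rewrite !expnMn mulnC (expnAC q).
  by rewrite ltn_exp2r.
have Hmono j d : M <= 'C(j, d) -> m.+1 ^ s * q ^ 2 < q ^ 'C(j, d).
  move=> H; apply: (leq_trans Hmq); rewrite leq_pexp2l //.
(* When equation i is chosen, r - i + 1 parameters are left, so its degree is taken for e = r -
   i. *)
pose Ds := [seq min_degree (r - i) M | i <- iota 0 r].
have sDs : size Ds = r by rewrite size_map size_iota.
have rpos i : i < r -> 0 < r - i by rewrite subn_gt0.
have M1 : 1 < M by apply: ltnW.
have Hbound : m * q ^ s.-1 <= 2 * zarankiewicz m n s t.
  apply: (HE K k m n t a Ds) => //; rewrite -/q.
  - by rewrite /K; lia.
  - by rewrite /K; lia.
  - by rewrite k0 /K; lia.
  - move=> D /mapP[i]; rewrite mem_iota add0n => /andP[_ lti] ->.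
    have [/andP[-> le] _ _] := min_degreeP (rpos i lti) M1.
    by rewrite /K; lia.
  - exact: Hmono.
  - move=> i lti; apply: Hmono; rewrite /Ds (nth_map 0) ?size_iota // nth_iota // add0n.
    have [_ H _] := min_degreeP (rpos i lti) M1.
    by rewrite -bin_sub ?leq_addr // addKn.
  apply: leq_ltn_trans Ht; rewrite leq_mul2l; apply/orP; right.
  rewrite /Ds big_map -[r in iota 0 r]subn0 -/(index_iota 0 r) big_mkord.
  rewrite [X in _ <= X](reindex_inj rev_ord_inj) /=; apply: eq_leq.
  by apply: eq_bigr => i _; rewrite subnSK.
apply: (@leq_trans (m ^ s * ((2 * q) ^ s) ^ s.-1)).
  rewrite leq_mul2l; apply/orP; right.
  by case: (s.-1) => // j; rewrite leq_exp2r // ltnW.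
have -> : m ^ s * ((2 * q) ^ s) ^ s.-1 = (2 ^ s.-1 * (m * q ^ s.-1)) ^ s.
  by rewrite expnAC (expnMn 2 q) -expnMn mulnCA.
have -> : 2 ^ s = 2 ^ s.-1 * 2 by rewrite -expnSr prednK.
rewrite leq_exp2r // -mulnA leq_mul2l.
by rewrite Hbound orbT.
Qed.

Theorem zarankiewicz_random_power s m n t : 0 < s -> 0 < n ->
  m ^ s * (2 ^ s * n) < t`! -> m ^ s * n ^ s.-1 <= (2 * zarankiewicz m n s t) ^ s.
Proof.
move=> s0 n0 Ht.
have ex_b : exists b, n <= b ^ s.
  by exists n; rewrite -{1}[n]expn1; case: (n) n0 => // n1 _; rewrite leq_pexp2l.
have [b Hb bmin] := ex_minnP ex_b.
have b0 : 0 < b by case: b Hb {bmin} => //; rewrite exp0n // leqNgt n0.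
have b_le : b ^ s <= 2 ^ s * n.
  case: b b0 Hb bmin => // -[|b] _ Hb bmin.
    by rewrite exp1n muln_gt0 expn_gt0.
  apply: (@leq_trans (2 ^ s * b.+1 ^ s)); first by rewrite -expnMn leq_exp2r //; lia.
  rewrite leq_mul2l; apply/orP; right; apply: ltnW; rewrite ltnNge; apply/negP => /bmin.
  by rewrite ltnn.
have H : m * n <= b * zarankiewicz m n s t.
  apply: zarankiewicz_random => //; apply: leq_ltn_trans Ht.
  by rewrite leq_mul2l b_le orbT.
rewrite -(leq_pmul2r n0) -mulnA -expnSr prednK // -expnMn.
apply: (@leq_trans ((b * zarankiewicz m n s t) ^ s)); first by rewrite leq_exp2r.
by rewrite !expnMn mulnAC leq_mul2r b_le orbT.
Qed.
End LowerBounds.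

From mathcomp Require Import all_classical all_reals all_analysis.

Import Order.TTheory GRing.Theory Num.Theory.
Import numFieldNormedType.Exports.
Import LowerBounds.

Local Open Scope classical_set_scope.
Local Open Scope ring_scope.

(** * Logarithmic estimates *)

Section RealBounds.
Variable R : realType.
Implicit Types x y : R.

Lemma ln3_gt1 : 1 < ln (3 : R).
Proof.
rewrite -ltr_expR lnK ?posrE //.
have H6 : expR 1 = expR (6^-1 : R) ^+ 6.
  by rewrite -expRM_natl mulfV.
have H : expR (6^-1 : R) <= 6 / 5.
  have e0 := expR_gt0 (6^-1 : R); have := expR_ge1Dx (- 6^-1 : R).
  rewrite expRN => /(ler_wpM2r (ltW e0)); rewrite mulVf ?gt_eqF //; lra.
rewrite H6; apply: (@le_lt_trans _ _ ((6 / 5) ^+ 6)); last by lra.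
by rewrite lerXn2r // nnegrE ?expR_ge0 //; lra.
Qed.

Lemma ln_nat_gt1 (s : nat) : (3 <= s)%N -> 1 < ln (s%:R : R).
Proof.
move=> s3; apply: (lt_le_trans ln3_gt1).
by rewrite ler_ln ?posrE ?ltr0n ?ler_nat //; lia.
Qed.

Lemma zarankiewicz_root (s m n t : nat) : (0 < s)%N ->
  (m ^ s * n ^ s.-1 <= (2 ^ s * zarankiewicz m n s t) ^ s)%N ->
  (2 ^+ s)^-1 * (m%:R * n%:R `^ (1 - s%:R^-1)) <= (zarankiewicz m n s t)%:R :> R.
Proof.
move=> s0 H; have s_neq0 : (s%:R : R) != 0 by rewrite pnatr_eq0 -lt0n.
rewrite mulrC ler_pdivrMr ?exprn_gt0 // [X in _ <= X]mulrC.
rewrite -(@ler_pXn2r _ s) ?nnegrE ?mulr_ge0 ?powR_ge0 ?exprn_ge0 //.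
have -> : (m%:R * n%:R `^ (1 - s%:R^-1)) ^+ s = m%:R ^+ s * n%:R ^+ s.-1 :> R.
  rewrite exprMn; congr (_ * _); rewrite -[LHS]powR_mulrn ?powR_ge0 // -powRrM.
  rewrite mulrBl mul1r mulVf // -[RHS]powR_mulrn //; congr (_ `^ _).
  by rewrite -subn1 natrB.
have -> : m%:R ^+ s * n%:R ^+ s.-1 = (m ^ s * n ^ s.-1)%N%:R :> R.
  by rewrite natrM (natrX R m s) (natrX R n s.-1).
have -> : (2 ^+ s * (zarankiewicz m n s t)%:R) ^+ s =
          ((2 ^ s * zarankiewicz m n s t) ^ s)%N%:R :> R.
  by rewrite (natrX R (_ * _)%N s) natrM (natrX R 2 s).
by rewrite ler_nat.
Qed.

Lemma harmonic_le (r : nat) : \sum_(e < r.+1) (e.+1%:R)^-1 <= 1 + ln (r.+1%:R : R).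
Proof.
elim: r => [|r IH]; first by rewrite big_ord1 invr1 ln1 addr0.
rewrite big_ord_recr /=; apply: le_trans (lerD IH (lexx _)) _.
rewrite -addrA lerD2l -lerBrDl.
have -> : ln (r.+2%:R : R) - ln r.+1%:R = - ln (r.+1%:R / r.+2%:R).
  by rewrite ln_div ?posrE // opprB.
rewrite lerNr; have -> : r.+1%:R / r.+2%:R = 1 + - (r.+2%:R)^-1 :> R.
  apply: (mulIf (_ : r.+2%:R != 0)); first by rewrite pnatr_eq0.
  by rewrite divfK ?pnatr_eq0 // mulrDl mulNr mulVf ?pnatr_eq0 // -[r.+2]addn1 natrD; ring.
by apply: le_ln1Dx; rewrite ltrN2 invf_lt1 // ltr1n.
Qed.

(** Each degree is at most e M^(1/e), so the exponents of M form a harmonic sum. *)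
Lemma ln_prod_min_degree (r M : nat) : (1 < M)%N ->
  ln ((\prod_(e < r.+1) min_degree e.+1 M)%N%:R : R) <=
  r.+1%:R * ln r.+1%:R + ln M%:R * (1 + ln r.+1%:R).
Proof.
move=> M1.
have D0 (e : nat) : 0 < (min_degree e.+1 M)%:R :> R.
  by rewrite ltr0n; have [/andP[]] := min_degreeP (ltn0Sn e) M1.
have M0 : 0 < M%:R :> R by rewrite ltr0n; lia.
have le_term (e : 'I_r.+1) : ln ((min_degree e.+1 M)%:R : R) <= ln r.+1%:R + ln M%:R * (e.+1%:R)^-1.
  have [_ _ H] := min_degreeP (ltn0Sn e) M1.
  have e0 : 0 < e.+1%:R :> R by rewrite ltr0n.
  rewrite -(ler_pM2r e0) mulrDl divfK ?gt_eqF //.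
  rewrite [ln _ * _]mulr_natr [ln r.+1%:R * _]mulr_natr -!lnXn //.
  have -> : (min_degree e.+1 M)%:R ^+ e.+1 = (min_degree e.+1 M ^ e.+1)%N%:R :> R.
    by rewrite (natrX R (min_degree _ _) e.+1).
  apply: (@le_trans _ _ (ln (e.+1%:R ^+ e.+1 * M%:R))).
    rewrite ler_ln ?posrE ?exprn_gt0 ?mulr_gt0 ?exprn_gt0 //; last first.
      by rewrite ltr0n expn_gt0 -(ltr0n R) D0.
    by rewrite -(natrX R e.+1 e.+1) -natrM ler_nat.
  rewrite lnM ?posrE ?exprn_gt0 // lerD2r ler_ln ?posrE ?exprn_gt0 //.
  by rewrite lerXn2r // ?nnegrE ?ler0n // ler_nat.
apply: (@le_trans _ _ (\sum_(e < r.+1) (ln r.+1%:R + ln M%:R * (e.+1%:R)^-1))).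
  apply: le_trans (ler_sum _ (fun e _ => le_term e)).
  rewrite natr_prod; elim: r {le_term} => [|r IH]; first by rewrite !big_ord1.
  rewrite big_ord_recr [X in _ <= X]big_ord_recr /= lnM ?posrE ?prodr_gt0 //.
  by rewrite lerD2r.
rewrite big_split /= sumr_const card_ord -[ln _ *+ _]mulr_natl -mulr_sumr lerD2l.
by rewrite ler_wpM2l ?harmonic_le // ln_ge0 // ler1n; lia.
Qed.
End RealBounds.

Lemma bin_power_gap (k j : nat) : (1 < k)%N -> (1 < j)%N ->
  (j ^ k + 4 * k`! <= k`! * 'C(k + j, k))%N.
Proof.
move=> k1 j1; rewrite mulnC [X in (_ <= X)%N]mulnC bin_ffact.
elim: k k1 => // -[//|[|k]] IH _.
  have -> : ((2 + j) ^_ 2 = j.+2 * j.+1)%N by rewrite !ffactnS ffactn0 muln1.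
  by rewrite -mulnn (_ : 2`! = 2)%N //; nia.
have {IH} := IH isT; set A := (_ ^_ _) => H.
rewrite addSn ffactnS succnK -/A factS (expnS j k.+2).
apply: leq_trans (leq_mul (leqnn _) H); rewrite -addSn mulnDl -mulnA.
by rewrite [X in (X <= _)%N]addnC leq_add // leq_mul2l ?leq_addl ?leq_addr orbT.
Qed.

(** * Part (a): t exponential in s *)

Section ExponentialBound.
Variable R : realType.

Lemma ln_exponents (m n s M : nat) : (0 < m)%N -> (0 < n)%N ->
  s%:R ^+ 2 * ln (m%:R : R) + s%:R ^+ 2 * ln 2 + s%:R * M%:R * ln 2 <= M%:R * ln n%:R ->
  (m.+1 ^ (s * s) * (2 ^ s) ^ M <= n ^ M)%N.
Proof.
move=> m0 n0 H.
have m0' : 0 < m%:R :> R by rewrite ltr0n.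
have n0' : 0 < n%:R :> R by rewrite ltr0n.
rewrite -(ler_nat R) natrM (natrX R m.+1 (s * s)) (natrX R (2 ^ s) M) (natrX R n M).
rewrite (natrX R 2 s) -exprM.
rewrite -ler_ln ?posrE ?mulr_gt0 ?exprn_gt0 //.
rewrite lnM ?posrE ?exprn_gt0 // !lnXn //.
rewrite -[ln m.+1%:R *+ _]mulr_natl -[ln 2 *+ _]mulr_natl -[ln n%:R *+ _]mulr_natl.
apply: le_trans H; rewrite !natrM lerD2r -mulrDr -expr2 ler_wpM2l ?exprn_ge0 //.
rewrite -lnM ?posrE // ler_ln ?posrE ?mulr_gt0 // -natrM ler_nat; lia.
Qed.

(** With r the integer part of s / log^2 s and [M] about s^k / (k! log^(2k) s), the hypothesis on
    log_n m gives s^2 log m <= M log n, and the one on k bounds log M. *)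
Lemma exponential_bound (s : nat) : (3 <= s)%N ->
  exists2 c : R, 0 < c &
    forall t m n k : nat,
      (3 <= t)%N -> (3 <= m)%N -> (3 <= n)%N -> (3 <= k)%N ->
      logb n%:R m%:R <=
        s%:R ^+ (k - 2)%N / (k`!%:R * ln (s%:R : R) ^+ (2 * k)%N) ->
      k%:R <= s%:R / (2 * ln (s%:R : R) ^+ 3) ->
      k%:R ^+ s * expR (2 * s%:R / ln s%:R) < t%:R :> R ->
      c * (m%:R * n%:R `^ (1 - s%:R^-1)) <= (zarankiewicz m n s t)%:R.
Proof.
move=> s3; set l := ln (s%:R : R).
have l1 : 1 < l by apply: ln_nat_gt1.
have l0 : 0 < l by apply: lt_trans l1.
have l0' : 0 <= l by apply: ltW.
have l1' : 1 <= l by apply: ltW.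
have s0 : 0 < s%:R :> R by rewrite ltr0n; lia.
have sN0 : (0 < s)%N by lia.
set r := Num.truncn (s%:R / l ^+ 2).
have l2 : 1 <= l ^+ 2 by rewrite exprn_ege1 // ltW.
have /andP[r_le r_gt] : r%:R <= s%:R / l ^+ 2 < r.+1%:R.
  by apply: truncn_itv; rewrite divr_ge0 // exprn_ge0 // ltW.
have r_le_s : (r <= s)%N.
  rewrite -(ler_nat R); apply: le_trans r_le _.
  by rewrite ler_pdivrMr ?exprn_gt0 // ler_peMr // ltW.
have [E HE] := @zarankiewicz_algebraic_power s r sN0.
(* As k <= s, also M <= s^k <= s^s, so the threshold n0 depends on s alone. *)
have [Mmax EMmax] : exists x, x = (s ^ s)%N by exists (s ^ s)%N.
have [Kmax EKmax] : exists x, x = (s + Mmax + s + s + 2)%N by eexists.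
have [n0 En0] : exists x, x = ((2 * Kmax ^ E) ^ s * 2 ^ (s * s + s * Mmax))%N by eexists.
exists ((2 ^+ s)^-1 * n0.+1%:R^-1); first by rewrite mulr_gt0 ?invr_gt0 ?exprn_gt0.
move=> t m n k t3 m3 n3 k3 Hlog Hk Ht.
have t1 : (1 < t)%N by apply: ltnW.
have n_gt0 : (0 < n)%N by apply: leq_trans n3.
have m_gt0 : (0 < m)%N by apply: leq_trans m3.
have k_gt0 : (0 < k)%N by apply: leq_trans k3.
have X0 : 0 <= m%:R * n%:R `^ (1 - s%:R^-1) :> R by rewrite mulr_ge0 ?powR_ge0.
have n0' : 0 < n%:R :> R by rewrite ltr0n.
have m0' : 0 < m%:R :> R by rewrite ltr0n.
have two1 : (2 ^+ s)^-1 <= 1 :> R.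
  by rewrite invf_le1 ?exprn_gt0 // exprn_ege1 // ler1n.
(* For n below n0, joining all left vertices to one right vertex gives enough edges. *)
case: (ltnP n n0) => [lt_n|le_n].
  apply: (@le_trans _ _ m%:R); last first.
    by rewrite ler_nat zarankiewicz_ge_left.
  apply: (@le_trans _ _ (1 * n0.+1%:R^-1 * (m%:R * n0.+1%:R))).
    apply: ler_pM => //; first by rewrite ler_wpM2r.
    rewrite ler_pM2l //; apply: (@le_trans _ _ n%:R); last by rewrite ler_nat leqW // ltnW.
    apply: (@le_trans _ _ (n%:R `^ 1)); last by rewrite powRr1.
    by apply: ler_powR; rewrite ?ler1n // lerBlDr lerDl invr_ge0.
  by rewrite mul1r mulrCA mulVf ?mulr1 // pnatr_eq0.
have Hfin : (m ^ s * n ^ s.-1 <= (2 ^ s * zarankiewicz m n s t) ^ s)%N.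
  pose M0 : R := s%:R ^+ k / (k`!%:R * l ^+ (2 * k)).
  have lk : 0 < l ^+ (2 * k) by rewrite exprn_gt0.
  have l3 : 1 <= l ^+ 3 by rewrite exprn_ege1 // ltW.
  have fk0 : 0 < k`!%:R :> R by rewrite ltr0n fact_gt0.
  have M0_ge0 : 0 <= M0 by rewrite divr_ge0 ?exprn_ge0 ?mulr_ge0 ?ltW.
  have /andP[tr_le tr_gt] := truncn_itv M0_ge0.
  (* With this M the number M - 2 exceeds M0 + 1, and the spare ln n absorbs the terms in ln 2.
     [bin_power_gap] has a surplus of 4 to match. *)
  set M := (Num.truncn M0 + 4)%N.
  have Hk' : k%:R * (2 * l ^+ 3) <= s%:R.
    by rewrite -ler_pdivlMr // mulr_gt0 // exprn_gt0.
  have k_le_s : (k <= s)%N.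
    rewrite -(ler_nat R); apply: le_trans Hk'.
    by rewrite ler_peMr //; lra.
  have r_ge : (0 < r)%N.
    rewrite -(ltr_nat R) -(ltrD2r 1) add0r; apply: le_lt_trans (_ : s%:R / l ^+ 2 < _).
      rewrite ler_pdivlMr ?exprn_gt0 // mul1r; apply: le_trans Hk'.
      have K1 : l ^+ 2 <= l ^+ 3 by rewrite (exprS l 2) ler_peMl ?exprn_ge0.
      have K2 : 2 * l ^+ 3 <= k%:R * (2 * l ^+ 3).
        by rewrite ler_peMl ?ler1n // mulr_ge0 // exprn_ge0.
      lra.
    by move: r_gt; rewrite -natr1.
  have M_bin : (M <= 'C(k + r.+1, k))%N.
    have := bin_power_gap (ltnW k3 : (1 < k)%N) (r_ge : (1 < r.+1)%N).
    rewrite -(ler_nat R) natrD natrM (natrX R r.+1 k) natrM => H.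
    have K1 : M0 * k`!%:R <= r.+1%:R ^+ k.
      have -> : M0 * k`!%:R = (s%:R / l ^+ 2) ^+ k.
        rewrite expr_div_n -exprM /M0 invfM mulrA mulrAC divfK // gt_eqF //.
      rewrite lerXn2r ?nnegrE //; last exact: ltW.
      by rewrite divr_ge0 // exprn_ge0 // ltW.
    rewrite -(ler_nat R) -(ler_pM2r fk0) /M natrD mulrDl.
    apply: (@le_trans _ _ (M0 * k`!%:R + 4 * k`!%:R)).
      by rewrite lerD2r ler_pM2r.
    by rewrite [X in _ <= X]mulrC; lra.
  have M_le : (M <= s ^ k)%N.
    have K1 : 27 <= s%:R ^+ k :> R.
      rewrite -(natrX R s k) (ler_nat R 27); apply: (@leq_trans (s ^ 3)).
        by rewrite (@leq_exp2r 3 s 3).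
      by rewrite leq_pexp2l.
    have K2 : 6 <= k`!%:R * l ^+ (2 * k) :> R.
      apply: (@le_trans _ _ (k`!%:R)); last first.
        by rewrite ler_peMr ?exprn_ege1 // ltW.
      by rewrite (ler_nat R 6) (@leq_fact 3 k).
    have K3 : M0 <= s%:R ^+ k / 6.
      rewrite /M0 ler_wpM2l ?exprn_ge0 // lef_pV2 // posrE //; lra.
    rewrite -(ler_nat R) /M natrD (natrX R s k); lra.
  have M_max : (M <= Mmax)%N.
    by apply: leq_trans M_le _; rewrite EMmax leq_pexp2l.
  apply: (HE k m n t M) => //.
  - by rewrite /M addn4.
  - apply: (@ln_exponents m n s (M - 2)%N) => //.
    have EA : (M - 2)%N%:R = (Num.truncn M0)%:R + 2 :> R.
      by rewrite /M -addnBA // natrD.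
    set A : R := (M - 2)%N%:R in EA *.
    have lnn : 0 < ln (n%:R : R) by apply: ln_gt0; rewrite ltr1n; apply: leq_trans n3.
    have ln2 : 0 <= ln (2 : R) by rewrite ln_ge0 // ler1n.
    have H1 : s%:R ^+ 2 * ln m%:R <= M0 * ln (n%:R : R).
      have -> : M0 = s%:R ^+ 2 * (s%:R ^+ (k - 2) / (k`!%:R * l ^+ (2 * k))).
        by rewrite mulrA -exprD subnKC // ltnW.
      by rewrite -[X in _ <= X]mulrA ler_wpM2l ?exprn_ge0 // -ler_pdivrMr.
    have H2 : (s%:R ^+ 2 + s%:R * Mmax%:R) * ln 2 <= ln (n%:R : R).
      have -> : (s%:R ^+ 2 + s%:R * Mmax%:R) * ln 2 = ln (2 ^+ (s * s + s * Mmax) : R).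
        by rewrite lnXn // -[ln 2 *+ _]mulr_natl natrD !natrM expr2.
      rewrite ler_ln ?posrE ?exprn_gt0 //.
      rewrite -(natrX R 2 (s * s + s * Mmax)) ler_nat; apply: leq_trans le_n.
      rewrite En0 leq_pmull // expn_gt0 muln_gt0 /= expn_gt0.
      by rewrite EKmax addn2.
    have H3 : s%:R * A * ln 2 <= s%:R * Mmax%:R * ln 2.
      rewrite ler_wpM2r // ler_wpM2l // ler_nat.
      by apply: leq_trans M_max; apply: leq_subr.
    have H4 : (M0 + 1) * ln n%:R <= A * ln (n%:R : R).
      rewrite ler_pM2r // EA; move: tr_gt; rewrite -natr1; lra.
    move: H1 H2 H3 H4; rewrite !mulrDl mul1r; lra.
  - apply: leq_trans le_n; rewrite En0.
    apply: (@leq_trans ((2 * Kmax ^ E) ^ s)); last by rewrite leq_pmulr // expn_gt0.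
    rewrite leq_exp2r // leq_mul2l; case: (E) => // E'.
    by rewrite leq_exp2r // EKmax; move: M_max k_le_s r_le_s; clear; lia.
  have [r' Er'] : exists r', r = r'.+1 by exists r.-1; rewrite prednK.
  have M1 : (1 < M)%N by rewrite /M addn4.
  have Hln := ln_prod_min_degree R r' M1; rewrite -Er' in Hln.
  set P : nat := (\prod_(e < r) min_degree e.+1 M)%N in Hln *.
  have P0 : 0 < P%:R :> R.
    rewrite ltr0n /P; apply: prodn_gt0 => e.
    by have [/andP[]] := min_degreeP (ltn0Sn e) M1.
  have r0 : 0 < r%:R :> R by rewrite ltr0n.
  have lnr : ln (r%:R : R) <= l by rewrite ler_ln ?posrE // ler_nat.
  have lnr0 : 0 <= ln (r%:R : R) by rewrite ln_ge0 // ler1n.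
  (* One half of the exponent 2s / log s; [L3] is the other half. *)
  have L1 : r%:R * ln r%:R <= s%:R / l.
    apply: (@le_trans _ _ (s%:R / l ^+ 2 * l)); first by rewrite ler_pM.
    by rewrite expr2 invfM mulrA divfK // gt_eqF.
  have L2 : ln (M%:R : R) <= s%:R / (2 * l ^+ 2).
    apply: (@le_trans _ _ (k%:R * l)).
      rewrite mulr_natl -lnXn // ler_ln ?posrE ?exprn_gt0 //; last by rewrite ltr0n ltnW.
      by rewrite -(natrX R s k) ler_nat.
    rewrite ler_pdivlMr ?mulr_gt0 ?exprn_gt0 //; apply: le_trans Hk'.
    by rewrite (_ : _ * _ * _ = k%:R * (2 * l ^+ 3)) //; ring.
  have L3 : ln M%:R * (1 + ln r%:R) <= s%:R / l.
    apply: (@le_trans _ _ (s%:R / (2 * l ^+ 2) * (2 * l))).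
      apply: ler_pM => //; first by rewrite ln_ge0 // ler1n ltnW.
        by rewrite addr_ge0.
      lra.
    rewrite expr2 (_ : _ * _ = s%:R / l) //.
    by field; rewrite gt_eqF.
  rewrite -(ltr_nat R) natrM (natrX R k s); apply: le_lt_trans Ht.
  rewrite ler_wpM2l ?exprn_ge0 // -[P%:R]lnK ?posrE // ler_expR.
  by apply: le_trans Hln _; rewrite -mulrA; lra.
have := zarankiewicz_root R sN0 Hfin; apply: le_trans.
rewrite mulrAC -[X in _ <= X]mulr1 ler_wpM2l //.
by rewrite invf_le1 // ler1n.
Qed.
End ExponentialBound.

Lemma pow2_le_fact (t : nat) : (2 ^ t.-1 <= t`!)%N.
Proof.
elim: t => [|[|t] IH] //; rewrite factS /= expnS leq_mul //.
Qed.

(** * Part (b): m close to n to a power of t *)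

Section LogarithmicBound.
Variable R : realType.

Lemma powR_eventually (p B : R) : 0 < p ->
  exists t0 : nat, forall t : nat, (t0 <= t)%N -> B <= t%:R `^ p.
Proof.
move=> p0; pose x := (`|B| + 1) `^ p^-1.
exists (Num.truncn x).+1 => t le_t.
have B1 : 0 <= `|B| + 1 by rewrite addr_ge0.
have x0 : 0 <= x by apply: powR_ge0.
have le_x : x <= t%:R.
  have /andP[_ /ltW] := truncn_itv x0; move=> /le_trans; apply; by rewrite ler_nat.
apply: (@le_trans _ _ (`|B| + 1)); first by rewrite (le_trans (ler_norm B)) // lerDl.
have -> : `|B| + 1 = x `^ p by rewrite /x -powRrM mulVf ?lt0r_neq0 // powRr1.
by apply: ge0_ler_powR; rewrite ?nnegrE //; apply: ltW.
Qed.

Lemma ln2_bounds : 1 / 2 <= ln (2 : R) <= 1.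
Proof.
apply/andP; split; last first.
  by have := @le_ln1Dx R 1; rewrite (_ : 1 + 1 = 2) //; apply; lra.
rewrite -ler_expR lnK ?posrE //.
have e0 := expR_gt0 (1 / 2 : R); have := expR_ge1Dx (- (1 / 2) : R).
by rewrite expRN => /(ler_wpM2r (ltW e0)); rewrite mulVf ?gt_eqF //; lra.
Qed.

(** ln t! is at least (u^6 - 1) / 2, while m^s and n contribute at most u^5 and u^3. *)
Lemma random_regime (s m n t : nat) (u : R) : (0 < m)%N -> (0 < n)%N ->
  2 * s%:R + 10 <= u -> t%:R = u ^+ 6 ->
  s%:R * ln (m%:R : R) <= u ^+ 5 -> ln (n%:R : R) <= u ^+ 3 ->
  (m ^ s * (2 ^ s * n) < t`!)%N.
Proof.
move=> m0 n0 Hu Et Hm Hn; apply: leq_trans (pow2_le_fact t).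
have m0' : 0 < m%:R :> R by rewrite ltr0n.
have n0' : 0 < n%:R :> R by rewrite ltr0n.
have s_ge0 : 0 <= s%:R :> R by [].
have u10 : 10 <= u by lra.
have u1 : 1 <= u by lra.
have p5 : 1 <= u ^+ 5 by rewrite exprn_ege1.
have p35 : u ^+ 3 <= u ^+ 5 by rewrite ler_weXn2l.
have p6 : (2 * s%:R + 10) * u ^+ 5 <= u ^+ 6.
  by rewrite (exprS u 5) ler_wpM2r // exprn_ge0 //; lra.
have ps : 2 * s%:R <= 2 * s%:R * u ^+ 5 by rewrite ler_peMr // mulr_ge0.
have t0 : (0 < t)%N by rewrite -(ltr0n R) Et exprn_gt0 //; lra.
have Et1 : t.-1%:R = u ^+ 6 - 1 :> R by rewrite -Et -subn1 natrB.
rewrite -(ltr_nat R) natrM natrM (natrX R m s) (natrX R 2 s) (natrX R 2 t.-1).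
rewrite -ltr_ln ?posrE ?mulr_gt0 ?exprn_gt0 //.
rewrite !lnM ?posrE ?mulr_gt0 ?exprn_gt0 // !lnXn //.
rewrite -[ln m%:R *+ _]mulr_natl -[ln 2 *+ s]mulr_natl -[ln 2 *+ _]mulr_natl Et1.
have /andP[l2 l2'] := ln2_bounds.
have H1 : s%:R * ln 2 <= s%:R :> R by rewrite ler_piMr.
have H2 : (u ^+ 6 - 1) * (1 / 2) <= (u ^+ 6 - 1) * ln 2.
  by rewrite ler_wpM2l //; lra.
move: p6; rewrite mulrDl; lra.
Qed.

(** From y >= 6 follows M - 2 >= y / 2, so the term in m takes at most a quarter of (M - 2) ln n,
    and the terms in ln 2 at most a half. *)
Lemma algebraic_regime_exponents (s m n M : nat) (y : R) :
  (0 < m)%N -> (0 < n)%N -> (2 < M)%N -> 6 <= y -> y < M%:R + 1 ->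
  s%:R ^+ 2 * ln m%:R <= y / 8 * ln (n%:R : R) ->
  2 * (s%:R ^+ 2 + s%:R) <= ln (n%:R : R) ->
  (m.+1 ^ (s * s) * (2 ^ s) ^ (M - 2) <= n ^ (M - 2))%N.
Proof.
move=> m0 n0 M2 y6 yM H1 H2; apply: (@ln_exponents R m n s (M - 2)) => //.
have /andP[l2 l2'] := ln2_bounds.
have EA : (M - 2)%N%:R = M%:R - 2 :> R by rewrite natrB // ltnW.
set A : R := (M - 2)%N%:R in EA *.
have A1 : 1 <= A by rewrite EA; lra.
have A0 : 0 <= A by rewrite (le_trans _ A1).
have Ay : y / 8 <= A / 4 by rewrite EA; lra.
have lnn : 0 <= ln (n%:R : R) by rewrite ln_ge0 // ler1n.
have H1' : s%:R ^+ 2 * ln m%:R <= A / 4 * ln (n%:R : R).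
  by apply: (le_trans H1); rewrite ler_wpM2r.
have H3 : A * (s%:R ^+ 2 + s%:R) <= A * (ln (n%:R : R) / 2).
  rewrite ler_wpM2l //; lra.
have H4 : s%:R ^+ 2 * ln 2 <= s%:R ^+ 2 * A.
  by rewrite ler_wpM2l ?exprn_ge0 //; apply: le_trans A1.
have H5 : s%:R * A * ln 2 <= s%:R * A by rewrite ler_piMr // mulr_ge0.
have H6 : 0 <= A * ln (n%:R : R) by rewrite mulr_ge0.
move: H1' H3 H4 H5 H6; clear; nra.
Qed.

Lemma algebraic_regime_size (s r k M E n : nat) (w : R) : s = r.+2 ->
  2 * s%:R + 12 * s%:R * E%:R + 10 <= w -> k%:R <= w ^+ 4 -> M%:R <= w ^+ 4 ->
  (0 < n)%N -> w ^+ 6 <= ln (n%:R : R) ->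
  ((2 * (k + M + s + r.+1 + 2) ^ E) ^ s <= n)%N.
Proof.
move=> Er Hw k_le M_le n0 lt_n; set K := (k + M + s + r.+1 + 2)%N.
have /andP[l2 l2'] := ln2_bounds.
have sE0 : 0 <= 12 * s%:R * E%:R :> R by rewrite !mulr_ge0.
have s_ge0 : 0 <= s%:R :> R by [].
have w1 : 1 <= w by lra.
have w0 : 0 < w by lra.
have K_le : K%:R <= w ^+ 12.
  have s_r : s%:R = r%:R + 2 :> R by rewrite Er -addn2 natrD.
  have w4 : 1 <= w ^+ 4 by rewrite exprn_ege1.
  have H1 : (2 * s%:R + 10) * w ^+ 4 <= w ^+ 12.
    apply: (@le_trans _ _ (w ^+ 5)); last by rewrite ler_weXn2l.
    by rewrite (exprS w 4) ler_wpM2r ?exprn_ge0 ?(ltW w0) //; lra.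
  have H2 : 2 * s%:R <= 2 * s%:R * w ^+ 4 by rewrite ler_peMr // mulr_ge0.
  rewrite /K !natrD -natr1; move: H1; rewrite mulrDl; lra.
have K0 : 0 < K%:R :> R by rewrite ltr0n /K addn2.
have n0' : 0 < n%:R :> R by rewrite ltr0n.
rewrite -(ler_nat R) (natrX R (2 * K ^ E) s) natrM (natrX R K E).
rewrite -ler_ln ?posrE ?exprn_gt0 ?mulr_gt0 ?exprn_gt0 // lnXn ?mulr_gt0 ?exprn_gt0 //.
rewrite lnM ?posrE ?exprn_gt0 // lnXn // -[_ *+ s]mulr_natl -[_ *+ E]mulr_natl.
apply: le_trans lt_n.
have lnK : ln K%:R <= 12 * w.
  apply: (@le_trans _ _ (ln (w ^+ 12))); first by rewrite ler_ln ?posrE ?exprn_gt0.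
  by rewrite lnXn // -(mulr_natl (ln w) 12) ler_pM2l // ltW // ln_sublinear.
have H1 : s%:R * (E%:R * ln K%:R) <= s%:R * (E%:R * (12 * w)) by rewrite !ler_wpM2l.
have H2 : s%:R * ln 2 <= s%:R * w by rewrite ler_wpM2l //; apply: le_trans w1.
have H3 : (2 * s%:R + 12 * s%:R * E%:R) * w <= w ^+ 6.
  apply: (@le_trans _ _ (w ^+ 2)); last by rewrite ler_weXn2l.
  by rewrite expr2 ler_wpM2r ?(ltW w0) //; lra.
have H4 : 0 <= s%:R * w by rewrite mulr_ge0 // ltW.
move: H1 H2 H3 H4; clear; rewrite mulrDr mulrDl; lra.
Qed.

(** There are s - 1 equations. In logarithms, k^s contributes s l + ln M and the product at most s l
    + (1 + l) ln M; as l > 1 the sum is at most 2 s l + (1 + 2 l) ln M. *)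
Lemma algebraic_regime_degrees (s r M t : nat) : s = r.+2 -> (3 <= s)%N ->
  let l := ln (s%:R : R) in (0 < t)%N -> (1 < M)%N ->
  M%:R <= expR (- (2 * s%:R * l + 1)) * t%:R `^ (1 + 2 * l)^-1 ->
  (min_degree s M ^ s * \prod_(e < r.+1) min_degree e.+1 M < t)%N.
Proof.
move=> Er s3 l t0 M1 M_le; have l1 : 1 < l by apply: ln_nat_gt1.
have sN0 : (0 < s)%N by rewrite Er.
have s0 : 0 < s%:R :> R by rewrite ltr0n.
have t0' : 0 < t%:R :> R by rewrite ltr0n.
have M0 : 0 < M%:R :> R by rewrite ltr0n ltnW.
have [/andP[k0 kM] _ kpow] := min_degreeP sN0 M1.
set k := min_degree s M in k0 kM kpow *.
have k0' : 0 < k%:R :> R by rewrite ltr0n.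
have Hln := ln_prod_min_degree R r M1.
set P : nat := (\prod_(e < r.+1) min_degree e.+1 M)%N in Hln *.
have P0 : 0 < P%:R :> R.
  rewrite ltr0n /P; apply: prodn_gt0 => e.
  by have [/andP[]] := min_degreeP (ltn0Sn e) M1.
rewrite -(ltr_nat R) natrM (natrX R k s) -ltr_ln ?posrE ?mulr_gt0 ?exprn_gt0 //.
rewrite lnM ?posrE ?exprn_gt0 //.
have lnM0 : 0 <= ln (M%:R : R) by rewrite ln_ge0 // ler1n ltnW.
have Hks : ln (k%:R ^+ s) <= s%:R * l + ln (M%:R : R).
  apply: (@le_trans _ _ (ln ((s ^ s * M)%N%:R : R))).
    rewrite -(natrX R k s) ler_ln ?posrE ?ler_nat // ltr0n ?muln_gt0 ?expn_gt0 ?k0 ?sN0 //.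
    by rewrite ltnW.
  rewrite natrM (natrX R s s) lnM ?posrE ?exprn_gt0 // lnXn //.
  by rewrite -[ln _ *+ s]mulr_natl.
have lnr : ln (r.+1%:R : R) <= l by rewrite ler_ln ?posrE // ler_nat Er.
have lnr0 : 0 <= ln (r.+1%:R : R) by rewrite ln_ge0 // ler1n.
have Hr : r.+1%:R * ln r.+1%:R <= s%:R * l.
  by rewrite ler_pM // ler_nat Er.
set C := 2 * s%:R * l in M_le; have C0 : 0 <= C.
  by rewrite /C !mulr_ge0 // ltW // (lt_trans _ l1).
set L := 1 + 2 * l in M_le; have L1 : 1 <= L by rewrite /L; lra.
have L0 : 0 < L by lra.
have HM : L * ln M%:R <= - (C + 1) + ln (t%:R : R).
  have H1 : ln M%:R <= - (C + 1) + L^-1 * ln (t%:R : R).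
    rewrite -ln_powR -[- (C + 1)]expRK -lnM ?posrE ?expR_gt0 ?powR_gt0 //.
    by rewrite ler_ln ?posrE ?mulr_gt0 ?expR_gt0 ?powR_gt0.
  apply: (@le_trans _ _ (L * (- (C + 1) + L^-1 * ln (t%:R : R)))); first by rewrite ler_pM2l.
  rewrite mulrDr mulrA divff ?gt_eqF // mul1r lerD2r mulrN lerN2.
  by rewrite ler_peMl // addr_ge0.
have H1 : ln M%:R * (1 + ln r.+1%:R) <= ln M%:R * (2 * l) :> R.
  rewrite ler_wpM2l //; lra.
move: HM Hln Hks Hr H1; rewrite /L /C mulrDl mul1r [2 * l * _]mulrC; clear; lra.
Qed.

(** Bounded t forces m^s <= n by the choice of c, and one full left vertex is enough. For larger t
    the border is ln n = t^(1/2): below it the colouring works since t^b <= t^(1/3), above it n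
    admits a field larger than the required power of K. *)
Lemma logarithmic_bound (s : nat) : (3 <= s)%N ->
  exists2 c : R, 0 < c &
  exists2 c' : R, 0 < c' &
  forall t m n : nat,
    (0 < t)%N -> (0 < m)%N -> (1 < n)%N ->
    logb n%:R m%:R <= c * t%:R `^ (1 + 2 * ln s%:R)^-1 ->
    c' * (m%:R * n%:R `^ (1 - s%:R^-1)) <= (zarankiewicz m n s t)%:R.
Proof.
move=> s3; set l := ln (s%:R : R); have l1 : 1 < l by apply: ln_nat_gt1.
have [r Er] : exists r, s = r.+2 by exists (s - 2)%N; lia.
have sN0 : (0 < s)%N by rewrite Er.
have s0 : 0 < s%:R :> R by rewrite ltr0n.
have s_ge3 : 3 <= s%:R :> R by rewrite (ler_nat R 3).
set L := 1 + 2 * l; have L3 : 3 <= L by rewrite /L; lra.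
set b := L^-1; have b0 : 0 < b by rewrite invr_gt0; lra.
have b3 : b <= 3^-1 by rewrite /b lef_pV2 ?posrE //; lra.
set C := 2 * s%:R * l; have C0 : 0 <= C by rewrite /C !mulr_ge0 //; lra.
set kap := expR (- (C + 1)).
have kap0 : 0 < kap by apply: expR_gt0.
have kap1 : kap <= 1 by rewrite /kap expR_le1; lra.
have [E HE] := @zarankiewicz_algebraic_power s r.+1 sN0.
have [t1 Ht1] := @powR_eventually 12^-1 (2 * s%:R + 12 * s%:R * E%:R + 10) ltac:(by rewrite invr_gt0).
have [t2 Ht2] := @powR_eventually b (6 / kap) b0.
set t0 := (t1 + t2)%N.
have T0 : 0 < t0.+1%:R :> R by rewrite ltr0n.
have T1 : 1 <= t0.+1%:R :> R by rewrite ler1n.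
(* This c makes s^2 ln m at most (y / 8) ln n for y = kap t^b, and s c t^b at most 1 when t < t0. *)
have [c [c0 Ec]] : exists c : R, 0 < c /\ 8 * (s%:R ^+ 2 * c) * t0.+1%:R = kap.
  exists (kap / (8 * s%:R ^+ 2 * t0.+1%:R)).
  split; first by rewrite divr_gt0 // !mulr_gt0 // exprn_gt0.
  by field; rewrite !gt_eqF.
have s2c0 : 0 <= 8 * (s%:R ^+ 2 * c) by rewrite !mulr_ge0 ?exprn_ge0 // ltW.
have c_k : 8 * (s%:R ^+ 2 * c) <= kap by rewrite -Ec ler_peMr.
have sc0 : 0 <= s%:R * c by rewrite mulr_ge0 // ltW.
have c_t : s%:R * c * t0.+1%:R <= 1.
  apply: le_trans kap1; rewrite -Ec ler_wpM2r ?ler0n //.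
  by rewrite expr2 -[_ * _ * c]mulrA mulrA ler_peMl //; lra.
have c_s : s%:R * c <= 1 by apply: le_trans c_t; rewrite ler_peMr.
exists c => //; exists (2 ^+ s)^-1; first by rewrite invr_gt0 exprn_gt0.
move=> t m n t_gt0 m0 n1 Hlog; apply: zarankiewicz_root => //.
have n0 : (0 < n)%N by apply: ltnW.
have n0' : 0 < n%:R :> R by rewrite ltr0n.
have m0' : 0 < m%:R :> R by rewrite ltr0n.
have t0' : 0 < t%:R :> R by rewrite ltr0n.
have t1' : 1 <= t%:R :> R by rewrite ler1n.
have lnn : 0 < ln (n%:R : R) by rewrite ln_gt0 // ltr1n.
have lnn' := ltW lnn.
have Hm : ln m%:R <= c * t%:R `^ b * ln (n%:R : R) by rewrite -ler_pdivrMr.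
have Hsm : s%:R * ln m%:R <= s%:R * c * t%:R `^ b * ln (n%:R : R).
  by rewrite -!mulrA ler_wpM2l // mulrA.
have tb0 : 0 <= t%:R `^ b :> R by apply: powR_ge0.
case: (ltnP t t0) => [lt_t|le_t].
  have Hmn : (m ^ s <= n)%N.
    rewrite -(ler_nat R) (natrX R m s) -ler_ln ?posrE ?exprn_gt0 // lnXn //.
    rewrite -[ln _ *+ s]mulr_natl; apply: (le_trans Hsm); rewrite ler_piMl //.
    apply: le_trans c_t; rewrite ler_wpM2l //.
    apply: (@le_trans _ _ t%:R); last by rewrite ler_nat leqW // ltnW.
    by apply: ler1_powR => //; move: b3; clear; lra.
  have Hz : (n <= zarankiewicz m n s t)%N by apply: zarankiewicz_ge_right => //; rewrite Er.
  apply: (@leq_trans (n ^ s)).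
    have -> : (n ^ s = n * n ^ s.-1)%N by rewrite -expnS prednK.
    by rewrite leq_mul.
  by rewrite leq_exp2r // (leq_trans Hz) // leq_pmull // expn_gt0.
(* A twelfth root, so that t^(1/6), t^(1/3) and t^(1/2) are integral powers of w. *)
set w := t%:R `^ 12^-1 : R.
have Hw : 2 * s%:R + 12 * s%:R * E%:R + 10 <= w by apply: Ht1; rewrite (leq_trans _ le_t) // leq_addr.
have Hk : 6 <= kap * t%:R `^ b.
  by rewrite mulrC -ler_pdivrMr //; apply: Ht2; rewrite (leq_trans _ le_t) // leq_addl.
have Etw : t%:R = w ^+ 12 by rewrite -powR_mulrn ?powR_ge0 // -powRrM mulVf // powRr1.
have sE0 : 0 <= 12 * s%:R * E%:R :> R by rewrite !mulr_ge0.
have w1 : 1 <= w by move: Hw sE0 s_ge3; clear; lra.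
have Htb : t%:R `^ b <= w ^+ 4.
  rewrite -powR_mulrn ?powR_ge0 // -powRrM; apply: ler_powR => //.
  by apply: (le_trans b3); rewrite (_ : 12^-1 * 4%:R = 3^-1 :> R) //; field.
case: (leP (ln (n%:R : R)) (w ^+ 6)) => [le_n|lt_n].
  have Hr : (m ^ s * (2 ^ s * n) < t`!)%N.
    apply: (@random_regime s m n t (w ^+ 2)) => //.
    - apply: (@le_trans _ _ w); first by move: Hw sE0; clear; lra.
      by rewrite expr2 ler_peMr // (le_trans _ w1).
    - by rewrite -exprM.
    - rewrite -exprM; apply: (@le_trans _ _ (w ^+ 4 * w ^+ 6)); last by rewrite -exprD.
      apply: (le_trans Hsm); rewrite ler_pM //; first by rewrite mulr_ge0.
      by apply: le_trans Htb; rewrite ler_piMl.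
    - by rewrite -exprM.
  have Hz := zarankiewicz_random_power sN0 n0 Hr.
  apply: (leq_trans Hz); rewrite leq_exp2r // leq_mul2r.
  by rewrite -{1}[2%N]expn1 leq_pexp2l // orbT.
set y := kap * t%:R `^ b in Hk.
have y0 : 0 <= y by apply: le_trans Hk.
have /andP[M_le M_gt] := truncn_itv y0.
set M := Num.truncn y in M_le M_gt.
have M_gt' : y < M%:R + 1 by rewrite natr1.
have M2 : (2 < M)%N by rewrite -(ltr_nat R); move: Hk M_gt'; clear; lra.
have M1 : (1 < M)%N by apply: ltnW.
have [/andP[k0 kM] kbin _] := min_degreeP sN0 M1.
have M_le4 : M%:R <= w ^+ 4.
  by apply: (le_trans M_le); apply: le_trans Htb; rewrite /y ler_piMl.
apply: (HE (min_degree s M) m n t M) => //.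
- by rewrite -Er -bin_sub ?leq_addr // addKn.
- apply: (algebraic_regime_exponents m0 n0 M2 Hk M_gt').
    apply: (@le_trans _ _ (s%:R ^+ 2 * (c * t%:R `^ b * ln (n%:R : R)))).
      by rewrite ler_wpM2l // exprn_ge0.
    rewrite mulrA ler_pM2r // mulrA /y ler_pdivlMr // mulrAC ler_wpM2r // mulrC.
    exact: c_k.
  apply: le_trans (ltW lt_n); apply: (@le_trans _ _ (w ^+ 2)); last by rewrite ler_weXn2l.
  apply: (@le_trans _ _ ((2 * s%:R + 10) ^+ 2)); last first.
    by rewrite lerXn2r ?nnegrE //; move: Hw sE0 s_ge3; clear; lra.
  by rewrite !expr2; move: s_ge3; clear; nra.
- apply: (algebraic_regime_size Er Hw _ M_le4 n0 (ltW lt_n)).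
  by apply: le_trans M_le4; rewrite ler_nat.
exact: (algebraic_regime_degrees Er s3 t_gt0 M1 M_le).
Qed.
End LogarithmicBound.

(** * The diagonal case m = n *)

Section Diagonal.
Variable R : realType.

Definition diagonal_bound (s : nat) (T : R) :=
  exists2 c : R, 0 < c &
    forall t n : nat, (0 < n)%N -> 3 `^ (s%:R + T) < t%:R ->
      c * n%:R `^ (2 - s%:R^-1) <= (zarankiewicz n n s t)%:R.

Lemma logb_refl (n : nat) : (1 < n)%N -> logb n%:R n%:R = 1 :> R.
Proof. by move=> n1; rewrite /logb divff // gt_eqF // ln_gt0 // ltr1n. Qed.

Lemma powR_two (n : nat) (a : R) : (0 < n)%N ->
  n%:R * n%:R `^ (1 - a) = n%:R `^ (2 - a) :> R.
Proof.
move=> n0; rewrite -{1}(@powRr1 R n%:R) // -powRD; last first.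
  by apply/implyP => _; rewrite pnatr_eq0 -lt0n.
by congr (_ `^ _); lra.
Qed.

Lemma pow3_ge (x : R) : x <= 3 `^ x.
Proof.
case: (leP x 0) => [x0|x0]; first by apply: le_trans x0 (powR_ge0 _ _).
rewrite /powR gt_eqF //; apply: le_trans (expR_ge1Dx _).
apply: (@le_trans _ _ (x * ln 3)); last by rewrite lerDr.
by rewrite ler_peMr ?ltW // ln3_gt1.
Qed.

(** For m = n the hypothesis of (b) reads 1 <= c t^b and holds once t is large, with no control of
    the threshold; it serves the finitely many small s. *)
Lemma diagonal_bound_exists (s : nat) : (3 <= s)%N -> exists T, diagonal_bound s T.
Proof.
move=> s3; have [c c0 [c' c'0 H]] := @logarithmic_bound R s s3.
have l1 : 1 < ln (s%:R : R) by apply: ln_nat_gt1.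
have [|t0 Ht0] := @powR_eventually R (1 + 2 * ln s%:R)^-1 c^-1.
  by rewrite invr_gt0; lra.
exists t0%:R; exists (Num.min c' 1); first by rewrite lt_min c'0 ltr01.
move=> t n n0 Ht; have lt_t : (t0 < t)%N.
  rewrite -(ltr_nat R); apply: le_lt_trans Ht; apply: le_trans (pow3_ge _).
  by rewrite lerDr.
have t_gt0 : (0 < t)%N by apply: leq_ltn_trans lt_t.
have s1 : (1 < s)%N by apply: ltnW.
case: (ltnP 1 n) => [n1|n1].
  have Hlog : logb n%:R n%:R <= c * t%:R `^ (1 + 2 * ln s%:R)^-1.
    by rewrite logb_refl // -ler_pdivrMl // mulr1; apply: Ht0; apply: ltnW.
  have := H t n n t_gt0 n0 n1 Hlog; rewrite powR_two //; apply: le_trans.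
  by rewrite ler_wpM2r ?powR_ge0 // ge_min lexx.
have -> : n = 1%N by apply/eqP; rewrite eqn_leq n1 n0.
apply: (@le_trans _ _ 1%:R); last by rewrite ler_nat zarankiewicz_ge_right.
by rewrite powR1 mulr1 ge_min lexx orbT.
Qed.

(** The inequalities are the hypotheses of (a) for k = 3 and log_n m = 1. *)
Lemma large_threshold : exists s0 : nat, forall s : nat, (s0 <= s)%N ->
  [/\ (3 <= s)%N, 6 * ln (s%:R : R) ^+ 6 <= s%:R & 6 * ln (s%:R : R) ^+ 3 <= s%:R].
Proof.
have [N N0] : exists2 N : R, 0 < N & forall x : R, 0 <= x -> x ^+ 7 <= N * expR x.
  exists (7`!%:R); first by rewrite ltr0n fact_gt0.
  move=> x x0; have := expR_ge1Dxn 6 x0; set e := expR x.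
  have f0 : 0 < 7`!%:R :> R by rewrite ltr0n fact_gt0.
  move=> H; rewrite -ler_pdivrMl // mulrC; apply: le_trans H; rewrite lerDr //.
move=> HN; exists (Num.truncn (expR (6 * N + 1))).+4 => s les.
have e0 : 0 <= expR (6 * N + 1) by apply: expR_ge0.
have /andP[_ gt_e] := truncn_itv e0.
have s3 : (3 <= s)%N by apply: leq_trans les; rewrite !ltnS.
have s0 : 0 < s%:R :> R by rewrite ltr0n; apply: leq_trans s3.
have le_e : expR (6 * N + 1) <= s%:R.
  apply: (le_trans (ltW gt_e)); rewrite ler_nat; apply: leq_trans les.
  by rewrite ltnS !leqW.
have := HN (ln s%:R); rewrite lnK ?posrE //; set l := ln s%:R.
have lN : 6 * N + 1 <= l by rewrite -ler_expR lnK ?posrE.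
have l0 : 0 <= l by lra.
have l1 : 1 <= l by lra.
move=> /(_ l0) H7.
have H6 : 6 * l ^+ 6 <= s%:R.
  rewrite -(ler_pM2l N0); apply: le_trans H7; rewrite (exprS l 6) mulrA.
  by rewrite ler_wpM2r ?exprn_ge0 //; lra.
split=> //; apply: le_trans H6.
by rewrite ler_wpM2l // ler_weXn2l.
Qed.

(** This T satisfies 3^T = e^(2s / ln s), the factor in (a) with k = 3. *)
Lemma diagonal_bound_large (s : nat) : (3 <= s)%N ->
  6 * ln (s%:R : R) ^+ 6 <= s%:R -> 6 * ln (s%:R : R) ^+ 3 <= s%:R ->
  diagonal_bound s (2 * s%:R / ln s%:R / ln 3).
Proof.
move=> s3 H6 H3; have [c c0 H] := @exponential_bound R s s3.
have l1 : 1 < ln (s%:R : R) by apply: ln_nat_gt1.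
set l := ln (s%:R : R) in H6 H3 H l1 *.
have l0 : 0 < l by apply: lt_trans l1.
have l3 := ln3_gt1 R.
have s1 : (1 < s)%N by apply: ltnW.
exists (Num.min c 4^-1); first by rewrite lt_min c0 invr_gt0 ltr0n.
move=> t n n0; have -> : 3 `^ (s%:R + 2 * s%:R / l / ln 3) = 3 ^+ s * expR (2 * s%:R / l) :> R.
  rewrite powRD; last by apply/implyP => _; rewrite pnatr_eq0.
  rewrite powR_mulrn // /powR gt_eqF // divfK // gt_eqF //.
  by apply: lt_trans l3.
move=> Ht; have t3 : (3 <= t)%N.
  rewrite -(ler_nat R); apply: le_trans (ltW Ht).
  have E1 : 1 <= expR (2 * s%:R / l).
    by rewrite -expR0 ler_expR divr_ge0 ?mulr_ge0 // ltW.
  apply: (@le_trans _ _ (3 ^+ s * 1)); last by rewrite ler_wpM2l // exprn_ge0.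
  by rewrite mulr1 -[X in X <= _]expr1 ler_weXn2l // ?ler1n // ltnW.
case: (ltnP 2 n) => [n3|n3].
  have Hlog : logb n%:R n%:R <= s%:R ^+ (3 - 2) / (3`!%:R * l ^+ (2 * 3)) :> R.
    rewrite logb_refl; last by apply: ltnW.
    rewrite ler_pdivlMr ?mul1r ?expr1 // mulr_gt0 ?exprn_gt0 // ltr0n //.
  have H3' : 3%:R <= s%:R / (2 * l ^+ 3) :> R.
    by rewrite ler_pdivlMr ?mulr_gt0 ?exprn_gt0 //; lra.
  have := H t n n 3%N t3 n3 n3 (leqnn 3) Hlog H3' Ht; rewrite powR_two //; apply: le_trans.
  by rewrite ler_wpM2r ?powR_ge0 // ge_min lexx.
(* Here n <= 2, so n^2 / 4 <= n; this accounts for the constant 1/4. *)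
apply: (@le_trans _ _ n%:R); last first.
  by rewrite ler_nat zarankiewicz_ge_right //; apply: leq_trans t3.
have n1 : 1 <= n%:R :> R by rewrite ler1n.
have n2 : n%:R <= 2 :> R by rewrite (ler_nat R n 2).
apply: (@le_trans _ _ (4^-1 * n%:R `^ 2%:R)).
  apply: ler_pM => //; first by rewrite le_min ltW //= invr_ge0 ler0n.
    by rewrite ge_min lexx orbT.
  by apply: ler_powR => //; rewrite lerBlDr lerDl invr_ge0.
by rewrite powR_mulrn // expr2; nra.
Qed.

Lemma diagonal_bounds : exists2 f : nat -> R,
    (f : nat -> R^o) =o_\oo (fun s : nat => s%:R : R^o) &
    forall s : nat, (3 <= s)%N -> diagonal_bound s (f s).
Proof.
have [s0 Hs0] := large_threshold.
have /choice [g Hg] : forall s : nat, exists T, (3 <= s)%N -> diagonal_bound s T.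
  move=> s; case: (leqP 3 s) => [/diagonal_bound_exists[T HT]|_]; first by exists T.
  by exists 0.
(* The finitely many values below s0 do not affect the o(s). *)
exists (fun s => if (s0 <= s)%N then 2 * s%:R / ln s%:R / ln 3 else g s); last first.
  move=> s s3; case: ifP => [/Hs0[_ H1 H2]|_]; last exact: Hg.
  exact: diagonal_bound_large.
apply/eqoP => e e0.
exists (s0 + (Num.truncn (expR (2 / e))).+1)%N => // s /= les.
have le0 : (s0 <= s)%N by apply: leq_trans les; apply: leq_addr.
have [s3 _ _] := Hs0 s le0; rewrite le0.
have s_gt0 : 0 < s%:R :> R by rewrite ltr0n; apply: leq_trans s3.
have l1 := @ln_nat_gt1 R s s3.
have l3 := ln3_gt1 R.
have e0' : 0 <= expR (2 / e) by apply: expR_ge0.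
have /andP[_ gt_e] := truncn_itv e0'.
have le_l : 2 / e <= ln s%:R.
  rewrite -ler_expR lnK ?posrE //; apply: (le_trans (ltW gt_e)).
  by rewrite ler_nat; apply: leq_trans les; apply: leq_addl.
have ll0 : 0 < ln (s%:R : R) by apply: lt_trans l1.
have l30 : 0 < ln (3 : R) by apply: lt_trans l3.
have f0 : 0 <= 2 * s%:R / ln s%:R / ln 3 :> R by apply: ltW; rewrite !divr_gt0 // mulr_gt0.
rewrite (ger0_norm f0) ger0_norm //.
rewrite ler_pdivrMr // ler_pdivrMr //; set l := ln s%:R in le_l ll0 *.
have H : 2 <= l * e by rewrite -ler_pdivrMr.
have H' : l * e <= l * e * ln 3 by rewrite ler_peMr ?ltW // mulr_gt0.
apply: (@le_trans _ _ (l * e * ln 3 * s%:R)); first by rewrite ler_pM2r // (le_trans H).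
by rewrite le_eqVlt; apply/orP; left; apply/eqP; ring.
Qed.
End Diagonal.

Theorem theorem2 (R : realType) :
  (* (a) *)
  (forall s : nat, (3 <= s)%N ->
    exists2 c : R, 0 < c &
    forall t m n k : nat,
      (3 <= t)%N -> (3 <= m)%N -> (3 <= n)%N -> (3 <= k)%N ->
      logb n%:R m%:R <=
        s%:R ^+ (k - 2)%N / (k`!%:R * ln (s%:R : R) ^+ (2 * k)%N) ->
      k%:R <= s%:R / (2 * ln (s%:R : R) ^+ 3) ->
      k%:R ^+ s * expR (2 * s%:R / ln s%:R) < t%:R :> R ->
      c * (m%:R * n%:R `^ (1 - s%:R^-1)) <= (zarankiewicz m n s t)%:R)
  /\
  (* (a), "in particular" part; f is the o(s) term *)
  (exists2 f : nat -> R,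
    (f : nat -> R^o) =o_\oo (fun s : nat => s%:R : R^o) &
    forall s : nat, (3 <= s)%N ->
      exists2 c : R, 0 < c &
      forall t n : nat, (0 < n)%N ->
        3 `^ (s%:R + f s) < t%:R ->
        c * n%:R `^ (2 - s%:R^-1) <= (zarankiewicz n n s t)%:R)
  /\
  (* (b) *)
  (forall s : nat, (3 <= s)%N ->
    exists2 c : R, 0 < c &
    exists2 c' : R, 0 < c' &
    forall t m n : nat,
      (0 < t)%N -> (0 < m)%N -> (1 < n)%N ->
      logb n%:R m%:R <= c * t%:R `^ (1 + 2 * ln s%:R)^-1 ->
      c' * (m%:R * n%:R `^ (1 - s%:R^-1)) <= (zarankiewicz m n s t)%:R).
Proof.
split; first exact: exponential_bound.
split; last exact: logarithmic_bound.
have [f Hf H] := diagonal_bounds R.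
by exists f.
Qed.
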